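(* Let $0<p\leq 1/2$ and let $f\in H_{p}(G_m)$. For $n\in\mathbb{N}_+$ let $N=N(n)$ denote the integer with $M_{N}<n\leq M_{N+1}$. Suppose that \[ \omega\left(\frac{1}{M_{N}},f\right)_{H_{p}}=o\left(\frac{1}{M_{N}^{1/p-2}\,N^{2\left[1/2+p\right]}}\right)\quad\text{as } N\rightarrow\infty , \] where $\left[1/2+p\right]$ denotes the integer part of $1/2+p$. Then \[ \left\Vert \sigma_{n}f-f\right\Vert_{p}\rightarrow 0\quad\text{as } n\rightarrow\infty . \]
   Context: Let $m=(m_0,m_1,\dots)$ be a bounded sequence of integers with $m_k\ge 2$ (bounded Vilenkin group). $G_m$ is the complete direct product of the cyclic groups $Z_{m_k}=\{0,\dots,m_k-1\}$ with the product topology and product Haar measure $\mu$ (each point of $Z_{m_k}$ has mass $1/m_k$), so $\mu(G_m)=1$. Put $M_0=1$, $M_{k+1}=m_kM_k$. Every $n\in\mathbb{N}$ is uniquely $n=\sum_j n_jM_j$ with $n_j\in Z_{m_j}$. The generalized Rademacher functions are $r_k(x)=\exp(2\pi\iota x_k/m_k)$ for $x=(x_0,x_1,\dots)\in G_m$, and the Vilenkin system is $\psi_n=\prod_k r_k^{n_k}$. For $x\in G_m$, $I_n(x)=\{y\in G_m: y_j=x_j,\ j<n\}$, and $\digamma_n$ is the $\sigma$-algebra generated by $\{I_n(x):x\in G_m\}$. For a martingale $f=(f^{(n)})$ with respect to $(\digamma_n)$, the maximal function is $f^*=\sup_n|f^{(n)}|$ and for $0<p<\infty$, $H_p(G_m)$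 is the space of martingales with $\|f\|_{H_p}:=\|f^*\|_p<\infty$, where $\|g\|_p=(\int_{G_m}|g|^pd\mu)^{1/p}$. The Fourier coefficients of a martingale are $\widehat f(i)=\lim_{k\to\infty}\int_{G_m}f^{(k)}\overline{\psi_i}\,d\mu$, the partial sums are $S_nf=\sum_{k=0}^{n-1}\widehat f(k)\psi_k$ ($S_0f=0$), and the Fejér means are $\sigma_nf=\frac1n\sum_{k=1}^nS_kf$. The modulus of continuity in $H_p$ is $\omega(1/M_n,f)_{H_p}:=\|f-S_{M_n}f\|_{H_p}$. *)

(* Defs.v *)
(* mathcomp-analysis (measure theory, Lebesgue integral,
   Lnorm) + real_closed's complex numbers R[i]. *)
From HB Require Import structures.
From mathcomp Require Import all_boot all_order all_algebra.
From mathcomp Require Import all_classical all_reals all_analysis.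
From mathcomp Require Import complex.

Set Implicit Arguments.
Unset Strict Implicit.
Unset Printing Implicit Defensive.
Import Order.TTheory GRing.Theory Num.Theory.
Import numFieldNormedType.Exports.
Local Open Scope classical_set_scope.
Local Open Scope ring_scope.
Local Open Scope complex_scope.

(* The sequence M_k and the digits n_k of n = sum_j n_j M_j.           *)
Fixpoint Mseq (m : nat -> nat) (k : nat) : nat :=
  if k is k'.+1 then (m k' * Mseq m k')%N else 1%N.

Definition digit (m : nat -> nat) (n k : nat) : nat :=
  ((n %/ Mseq m k) %% m k)%N.

(* The Vilenkin group G_m is modelled inside the carrier nat -> nat:
   G_m = [set x | forall k, x k < m k].  The measurable structure is the
   product sigma-algebra, generated by the cylinder sets
   cyl n a = { y | y_j = a_j, j < n }  (for a in G_m this is I_n(a)). *)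
Definition cyl (n : nat) (a : nat -> nat) : set (nat -> nat) :=
  [set y | forall j, (j < n)%N -> y j = a j].

Definition cylinders : set (set (nat -> nat)) :=
  [set A | exists n a, A = cyl n a].

Definition Gm := g_sigma_algebraType cylinders.

Definition Gm_set (m : nat -> nat) : set (nat -> nat) :=
  [set x | forall k, (x k < m k)%N].

(* mu is the (product) Haar measure of G_m, pushed into nat -> nat:
   every interval I_n(x), x in G_m, has measure 1/M_n, and cylinders over
   prefixes not in G_m are null (so mu is carried by G_m).  These values
   on the pi-system of cylinders determine mu uniquely. *)
Definition is_Haar {R : realType} (m : nat -> nat)
    (mu : {measure set Gm -> \bar R}) : Prop :=
  forall (n : nat) (a : nat -> nat),
    mu (cyl n a) =
      (if [forall j : 'I_n, (a j < m j)%N]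
       then ((Mseq m n)%:R)^-1 else 0)%:E.

(* Generalized Rademacher functions and the Vilenkin system.           *)
Definition rad {R : realType} (m : nat -> nat) (k : nat) (x : nat -> nat)
    : R[i] :=
  (cos (2 * pi * (x k)%:R / (m k)%:R)) +i* (sin (2 * pi * (x k)%:R / (m k)%:R)).

(* psi_n = prod_k r_k^{n_k}; n_k = 0 for k >= n since M_k >= 2^k > n. *)
Definition psi {R : realType} (m : nat -> nat) (n : nat) (x : nat -> nat)
    : R[i] :=
  \prod_(k < n) rad m k x ^+ digit m n k.

(* Martingales with respect to (F_n).                                  *)
(* F_n-measurable: constant on each atom I_n(x) of F_n. *)
Definition Fn_measurable {R : realType} (n : nat) (g : (nat -> nat) -> R[i])
    : Prop :=
  forall x y, (forall j, (j < n)%N -> x j = y j) -> g x = g y.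

(* E(f^(n+1) | F_n) = f^(n): equality of the integrals over every atom of
   F_n (real and imaginary parts). *)
Definition is_martingale {R : realType} (mu : {measure set Gm -> \bar R})
    (f : nat -> Gm -> R[i]) : Prop :=
  (forall n, Fn_measurable n (f n)) /\
  (forall n (a : nat -> nat),
     (\int[mu]_(x in cyl n a) (complex.Re (f n.+1 x))%:E =
      \int[mu]_(x in cyl n a) (complex.Re (f n x))%:E)%E /\
     (\int[mu]_(x in cyl n a) (complex.Im (f n.+1 x))%:E =
      \int[mu]_(x in cyl n a) (complex.Im (f n x))%:E)%E).

(* Maximal function f^* = sup_n |f^(n)| (extended-real valued). *)
Definition maxfun {R : realType} (f : nat -> Gm -> R[i]) (x : Gm) : \bar R :=
  ereal_sup (range (fun n => (ComplexField.Normc.normc (f n x))%:E)).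

(* ||f||_{H_p} = ||f^*||_p. *)
Definition Hp_norm {R : realType} (mu : {measure set Gm -> \bar R}) (p : R)
    (f : nat -> Gm -> R[i]) : \bar R :=
  Lnorm mu p%:E (maxfun f).

Definition in_Hp {R : realType} (mu : {measure set Gm -> \bar R}) (p : R)
    (f : nat -> Gm -> R[i]) : Prop :=
  is_martingale mu f /\ (Hp_norm mu p f < +oo)%E.

(* ||g||_p for a function g. *)
Definition Lp_norm {R : realType} (mu : {measure set Gm -> \bar R}) (p : R)
    (g : Gm -> R[i]) : \bar R :=
  Lnorm mu p%:E (fun x => (ComplexField.Normc.normc (g x))%:E).

(* Fourier coefficients, partial sums, Fejer means.                    *)
Definition fourier {R : realType} (m : nat -> nat)
    (mu : {measure set Gm -> \bar R}) (f : nat -> Gm -> R[i]) (i : nat)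
    : R[i] :=
  (limn (fun k => Rintegral mu setT
                   (fun x => complex.Re (f k x * (psi m i x)^*))))
  +i* (limn (fun k => Rintegral mu setT
                   (fun x => complex.Im (f k x * (psi m i x)^*)))).

(* S_n f = sum_{k<n} \hat f(k) psi_k  (S_0 f = 0). *)
Definition Spart {R : realType} (m : nat -> nat)
    (mu : {measure set Gm -> \bar R}) (f : nat -> Gm -> R[i]) (n : nat)
    (x : Gm) : R[i] :=
  \sum_(k < n) fourier m mu f k * psi m k x.

(* sigma_n f = (1/n) sum_{k=1}^n S_k f. *)
Definition fejer {R : realType} (m : nat -> nat)
    (mu : {measure set Gm -> \bar R}) (f : nat -> Gm -> R[i]) (n : nat)
    (x : Gm) : R[i] :=
  (n%:R)^-1 * \sum_(1 <= k < n.+1) Spart m mu f k x.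

(* Conditional expectation E(g | F_k)(x) = (1/mu(I_k(x))) int_{I_k(x)} g. *)
Definition condexp {R : realType} (mu : {measure set Gm -> \bar R}) (k : nat)
    (g : Gm -> R[i]) (x : Gm) : R[i] :=
  ((fine (mu (cyl k x)))^-1 * Rintegral mu (cyl k x) (fun y => complex.Re (g y)))
  +i* ((fine (mu (cyl k x)))^-1 * Rintegral mu (cyl k x) (fun y => complex.Im (g y))).

(* Modulus of continuity omega(1/M_n, f)_{H_p} = ||f - S_{M_n} f||_{H_p},
   where f - S_{M_n} f is the martingale (f^(k) - E(S_{M_n} f | F_k))_k. *)
Definition modcont {R : realType} (m : nat -> nat)
    (mu : {measure set Gm -> \bar R}) (p : R) (f : nat -> Gm -> R[i])
    (n : nat) : \bar R :=
  Hp_norm mu p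
    (fun k x => f k x - condexp mu k (Spart m mu f (Mseq m n)) x).

(* The function represented by the martingale f: the pointwise (a.e.)
   limit of f^(k). *)
Definition mart_lim {R : realType} (f : nat -> Gm -> R[i]) (x : Gm) : R[i] :=
  (limn (fun k => complex.Re (f k x))) +i* (limn (fun k => complex.Im (f k x))).

(* Main.v *)
Require Import Defs.
From HB Require Import structures.
From mathcomp Require Import all_boot all_order all_algebra.
From mathcomp Require Import all_classical all_reals all_analysis.
From mathcomp Require Import measurable_realfun complex.
From mathcomp Require Import zify ring lra.
Import Order.TTheory GRing.Theory Num.Theory.
Import numFieldNormedType.Exports.
Local Open Scope classical_set_scope.
Local Open Scope ring_scope.

Set Implicit Arguments.
Unset Strict Implicit.
Unset Printing Implicit Defensive.

(** Write [M_N < n <= M_(N+1)] and [d_j = f_(j+1) - f_j].  Then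
    [n (sigma_n f - f_N) = F_n * d_N - sum_(j < N) (M_(j+1) d_j - F_(M_(j+1)) * d_j)],
    where [F_n] is [n] times the Fejer kernel.  On [n <= M_(j+1)] the kernel is dominated by
    a function of the first [j] coordinates whose [p]-th moment is at most
    [C Lam_j] with [Lam_j = sum_(i <= j) M_i^(2p-1)]; since [d_j] is constant on the cylinders
    of length [j+1], [p]-subadditivity over these cylinders gives
    [int |F_n * d_j|^p <= C M_j^(1-p) Lam_j int |d_j|^p].  By the hypothesis on the modulus
    of continuity [M_j^(1-2p) Lam_j int |d_j|^p] tends to 0, and a geometric convolution of this
    sequence bounds [int |sigma_n f - f_N|^p].  Finally, [f_N] is compared with the pointwise
    limit through the tail maximal function [sup_(k >= N) |f_k - f_N|], which is dominated by
    the maximal function in the modulus of continuity. *)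

(** Since [p < 1], the functional [int |g|^p] is subadditive but obeys no Minkowski or Young
    inequality. Convolution with [d_j] is therefore treated as a finite sum over the [M_(j+1)]
    cylinders on which [d_j] is constant. Taking [p]-th powers termwise costs [M_(j+1)^(1-p)]; after
    division by [n^p] the top block retains [M_N^(1-2p)] up to a constant, the [p]-th power of the
    weight [M_N^(1/p-2)] in the hypothesis. The summand [M_i^(2p-1)] of [Lam_j] is the [p]-th moment
    of a spike of height [M_i^2] on a set of measure [1/M_i]. These sums stay bounded for [p < 1/2]
    and equal [j+1] at [p = 1/2], which is what the factor with [[1/2+p]] pays for. Early
    differences need not be small, but block [j] enters with [(M_j/n)^p <= 2^(-p(N-j))], so they are
    forgotten geometrically. Almost everywhere existence of the pointwise limit is not assumed: it
    is deduced from the smallness of the same tail maximal functions. *)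

Local Notation normc := ComplexField.Normc.normc.
Local Notation rad := Defs.rad.

(** * Mixed radix expansions *)

Section MixedRadix.
Context (m : nat -> nat) (hm2 : forall k, (2 <= m k)%N).

Lemma m_gt0 k : (0 < m k)%N.
Proof. by have := hm2 k; case: (m k). Qed.

Lemma Mseq_gt0 k : (0 < Mseq m k)%N.
Proof. by elim: k => //= k IH; rewrite muln_gt0 m_gt0. Qed.

Lemma MseqS k : Mseq m k.+1 = (m k * Mseq m k)%N.
Proof. by []. Qed.

Lemma Mseq_dvd j k : (j <= k)%N -> (Mseq m j %| Mseq m k)%N.
Proof.
elim: k => [|k IH]; first by rewrite leqn0 => /eqP ->.
by rewrite leq_eqVlt => /orP[/eqP -> //|/IH h]; rewrite MseqS dvdn_mull.
Qed.

Lemma Mseq_le j k : (j <= k)%N -> (Mseq m j <= Mseq m k)%N.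
Proof. by move=> /Mseq_dvd; apply: dvdn_leq; exact: Mseq_gt0. Qed.

Lemma leq_pow2_Mseq j k : (2 ^ k * Mseq m j <= Mseq m (j + k))%N.
Proof.
elim: k => [|k IH]; first by rewrite mul1n addn0.
by rewrite addnS MseqS expnS -mulnA leq_mul.
Qed.

Lemma ltn_Mseq k : (k < Mseq m k)%N.
Proof.
apply: leq_trans (ltn_expl k (isT : 1 < 2)%N) _.
by have := leq_pow2_Mseq 0 k; rewrite muln1.
Qed.

Lemma digit_lt n k : (digit m n k < m k)%N.
Proof. by rewrite ltn_mod m_gt0. Qed.

Lemma digit_small i K k : (i < Mseq m K)%N -> (K <= k)%N -> digit m i k = 0%N.
Proof.
move=> iK Kk; rewrite /digit divn_small ?mod0n//.
exact: leq_trans iK (Mseq_le Kk).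
Qed.

Lemma digitD_lt i a K k : (k < K)%N -> digit m (i + a * Mseq m K) k = digit m i k.
Proof.
move=> kK; have /dvdnP[q ->] := Mseq_dvd kK.
rewrite /digit MseqS !mulnA addnC divnMDl ?Mseq_gt0//.
by rewrite modnMDl.
Qed.

Lemma digitD_eq i a K : (i < Mseq m K)%N -> (a < m K)%N ->
  digit m (i + a * Mseq m K) K = a.
Proof.
move=> iK am; rewrite /digit addnC divnMDl ?Mseq_gt0// divn_small// addn0.
exact: modn_small.
Qed.

Lemma digits_inj K i j : (i < Mseq m K)%N -> (j < Mseq m K)%N ->
  (forall k, (k < K)%N -> digit m i k = digit m j k) -> i = j.
Proof.
elim: K i j => [|K IH] i j; first by rewrite !ltnS !leqn0 => /eqP -> /eqP ->.
rewrite MseqS => iK jK hd.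
rewrite (divn_eq i (Mseq m K)) (divn_eq j (Mseq m K)).
have M0 := Mseq_gt0 K.
congr addn; last first.
  apply: IH; rewrite ?ltn_mod// => k kK.
  have := hd k (ltnW kK); rewrite {1}(divn_eq i (Mseq m K)) {1}(divn_eq j (Mseq m K)).
  by rewrite ![(_ * _ + _)%N]addnC !digitD_lt.
congr muln; have := hd K (leqnn _).
by rewrite /digit !modn_small// ltn_divLR.
Qed.

Lemma digits_surj K (x : nat -> nat) : (forall k, (k < K)%N -> (x k < m k)%N) ->
  exists2 j, (j < Mseq m K)%N & forall k, (k < K)%N -> digit m j k = x k.
Proof.
elim: K => [|K IH] hx; first by exists 0%N.
have [j jK hj] := IH (fun k h => hx k (ltnW h)).
exists (j + x K * Mseq m K)%N.
  have := hx K (leqnn _); rewrite MseqS => xm.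
  apply: (@leq_trans (Mseq m K + x K * Mseq m K)%N); first by rewrite ltn_add2r.
  by rewrite -mulSn leq_mul2r xm orbT.
move=> k; rewrite ltnS leq_eqVlt => /orP[/eqP ->|kK].
  by rewrite digitD_eq// hx.
by rewrite digitD_lt// hj.
Qed.

Lemma ltn_MseqS i b K : (i < Mseq m K)%N -> (b < m K)%N ->
  (i + b * Mseq m K < Mseq m K.+1)%N.
Proof.
move=> iK bm; rewrite MseqS.
apply: (@leq_trans (Mseq m K + b * Mseq m K)%N); first by rewrite ltn_add2r.
by rewrite -mulSn leq_mul2r bm orbT.
Qed.

Lemma ltn_Mseq_le i j k : (i < Mseq m j)%N -> (j <= k)%N -> (i < Mseq m k)%N.
Proof. by move=> h /Mseq_le; apply: leq_trans. Qed.

End MixedRadix.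

Lemma sum_block (V : nmodType) (G : nat -> V) (M a : nat) :
  \sum_(i < a * M) G i = \sum_(b < a) \sum_(i < M) G (i + b * M)%N.
Proof.
elim: a => [|a IH]; first by rewrite mul0n !big_ord0.
rewrite mulSnr big_split_ord /= IH big_ord_recr /=; congr (_ + _).
by apply: eq_bigr => i _; rewrite addnC.
Qed.

(** * The complex modulus *)

Section Normc.
Context (R : realType).
Implicit Types (z w : R[i]).

Lemma normc_ge0 z : 0 <= normc z.
Proof. by case: z => a b /=; rewrite sqrtr_ge0. Qed.

Lemma normc_nat n : normc (n%:R : R[i]) = n%:R.
Proof.
elim: n => [|n IH]; first exact: ComplexField.Normc.normc0.
rewrite -[n.+1%:R]/(1 *+ n.+1 : R[i]).
have := @normcMn R (1 : R[i]) n.+1; rewrite ComplexField.Normc.normc1 => ->.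
by [].
Qed.

Lemma normcD_le z w : normc (z + w) <= normc z + normc w.
Proof. exact: le_normcD. Qed.

Lemma normc_sum I (r : seq I) (P : pred I) (G : I -> R[i]) :
  normc (\sum_(i <- r | P i) G i) <= \sum_(i <- r | P i) normc (G i).
Proof.
elim/big_ind2: _ => [|x1 x2 y1 y2 h1 h2|//]; first by rewrite ComplexField.Normc.normc0.
by apply: le_trans (normcD_le _ _) _; exact: lerD.
Qed.

Lemma normc_exp_le1 z n : normc z <= 1 -> normc (z ^+ n) <= 1.
Proof.
move=> z1; elim: n => [|n IH]; first by rewrite expr0 ComplexField.Normc.normc1.
by rewrite exprS ComplexField.Normc.normcM mulr_ile1// ?normc_ge0.
Qed.

End Normc.

(** * Pointwise bounds for Dirichlet and Fejer kernels *)

Section Kernel.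
Context (R : realType) (m : nat -> nat) (hm2 : forall k, (2 <= m k)%N).

(** The value of the [k]-th Rademacher function is left abstract as [rho k]: the choice [rad m k x]
    gives [psi], and the products [rad m k x * conjc (rad m k t)] give the kernels. *)
Definition chi (rho : nat -> R[i]) (i : nat) : R[i] :=
  \prod_(k < i) rho k ^+ digit m i k.

Lemma chiE rho K i : (i < Mseq m K)%N ->
  chi rho i = \prod_(k < K) rho k ^+ digit m i k.
Proof.
have widen K' L : (i < Mseq m K')%N -> (K' <= L)%N ->
    \prod_(k < L) rho k ^+ digit m i k = \prod_(k < K') rho k ^+ digit m i k.
  move=> iK; elim: L => [|L IH]; first by rewrite leqn0 => /eqP ->.
  rewrite leq_eqVlt => /orP[/eqP -> //|h].
  by rewrite big_ord_recr /= IH// (digit_small hm2 iK)// expr0 mulr1.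
move=> iK; rewrite /chi; have [h|/ltnW h] := leqP K i; first exact: widen.
by rewrite [RHS](@widen i)// ltn_Mseq.
Qed.

Lemma chiD rho K i b : (i < Mseq m K)%N -> (b < m K)%N ->
  chi rho (i + b * Mseq m K) = rho K ^+ b * chi rho i.
Proof.
move=> iK bm; rewrite (@chiE _ K.+1) ?ltn_MseqS// big_ord_recr /=.
rewrite digitD_eq// mulrC (@chiE _ K)//; congr (_ * _).
by apply: eq_bigr => k _; rewrite digitD_lt.
Qed.

(* For [rho k = r_k(x) conj(r_k(t))] these are the Dirichlet kernel and [n] times the Fejer
   kernel at [x - t]. *)
Definition Dker rho n : R[i] := \sum_(i < n) chi rho i.
Definition Fker rho n : R[i] := \sum_(i < n) (n - i)%:R * chi rho i.

(** For an index [i + b * M] with [i < M], the weight splits as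
    [n - i - b M = (n - (b+1) M) + (M - i)]. The first part is constant in [i] and multiplies a full
    Dirichlet kernel; the second reproduces the Fejer kernel of order [M]. The incomplete last block
    has weights [r - i]. *)
Lemma FkerE rho N a r : (r < Mseq m N)%N -> (a * Mseq m N + r <= Mseq m N.+1)%N ->
  Fker rho (a * Mseq m N + r) =
  \sum_(b < a) rho N ^+ b * ((a * Mseq m N + r - b.+1 * Mseq m N)%:R
       * Dker rho (Mseq m N) + Fker rho (Mseq m N)) + rho N ^+ a * Fker rho r.
Proof.
set M := Mseq m N => rM nM.
have M0 : (0 < M)%N := Mseq_gt0 hm2 N.
have am : (a <= m N)%N.
  rewrite -(leq_pmul2r M0); apply: leq_trans nM; exact: leq_addr.
(* [a = m N] is allowed, for [n = M_(N+1)], but then [r = 0]; only a nonempty last block requires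
   [a] to be a genuine digit. *)
have am' : (0 < r)%N -> (a < m N)%N.
  move=> r0; rewrite -(ltn_pmul2r M0); apply: leq_trans nM.
  by rewrite -addn1 leq_add2l.
rewrite /Fker big_split_ord /=.
rewrite (sum_block (fun i => (a * M + r - i)%:R * chi rho i)).
congr (_ + _).
- apply: eq_bigr => b _; rewrite !mulr_sumr -big_split mulr_sumr /=.
  apply: eq_bigr => i _; rewrite chiD//; last exact: leq_trans (ltn_ord b) am.
  rewrite mulrCA -mulrDl -natrD; congr (_ * (_%:R * _)).
  have bM : (b.+1 * M <= a * M)%N by rewrite leq_mul2r ltn_ord orbT.
  have iM := ltn_ord i; rewrite mulSn in bM *; lia.
- rewrite mulr_sumr; apply: eq_bigr => i _.
  have ir := ltn_ord i.
  rewrite [X in chi rho X]addnC chiD//; first last.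
    + by apply: am'; lia.
    + exact: ltn_trans rM.
  rewrite mulrCA; congr (_ * (_%:R * _)); lia.
Qed.

Lemma DkerE rho N : Dker rho (Mseq m N.+1) =
  (\sum_(b < m N) rho N ^+ b) * Dker rho (Mseq m N).
Proof.
rewrite /Dker MseqS (sum_block (chi rho)) mulr_suml; apply: eq_bigr => b _.
by rewrite mulr_sumr; apply: eq_bigr => i _; rewrite chiD.
Qed.

Section Bounds.
Context (rho : nat -> R[i]) (E : nat -> bool) (B : nat).
Hypotheses (rho1 : forall k, normc (rho k) <= 1).
Hypotheses (rhoE : forall k, E k -> rho k = 1).
Hypotheses (rhoN : forall k, ~~ E k -> \sum_(b < m k) rho k ^+ b = 0).
Hypotheses (hB : forall k, (m k <= B)%N).

(** Paley's lemma: by [DkerE] the kernel is a product of full geometric sums, each equal to [m k] on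
    [E k] and to 0 off it. *)
Lemma Dker_Mseq N : Dker rho (Mseq m N) = (all E (iota 0 N))%:R * (Mseq m N)%:R.
Proof.
elim: N => [|N IH]; first by rewrite /Dker big_ord1 /chi big_ord0 mulr1.
rewrite DkerE IH -addn1 iotaD all_cat /= andbT add0n addn1 MseqS.
case: (boolP (E N)) => EN; last by rewrite rhoN// andbF !mul0r.
rewrite andbT rhoE//; under eq_bigr do rewrite expr1n.
by rewrite sumr_const card_ord natrM mulrCA.
Qed.

Definition agree (j : nat) : R := (all E (iota 0 j))%:R.

(** Majorant of the Fejer kernel of order [M_j]. The Dirichlet part of [FkerE] has at most [B]
    terms, of weight at most [B M_j'] and modulus at most [M_j']. In the other part the exact factor
    [m j'] and the cancellation off [E j'] are kept, because they make the [p]-th moments contract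
    in [Phi_momentS]. *)
Fixpoint Phi j : R := if j is j'.+1 then
  B%:R ^+ 2 * (Mseq m j')%:R ^+ 2 * agree j' + (E j')%:R * (m j')%:R * Phi j' else 1.

Lemma Phi_ge0 j : 0 <= Phi j.
Proof.
elim: j => //= j IH; rewrite addr_ge0// mulr_ge0// ?ler0n// mulr_ge0//;
  by rewrite ?ler0n// exprn_ge0.
Qed.

Lemma agree_ge0 j : 0 <= agree j. Proof. exact: ler0n. Qed.

Lemma normc_Dker_Mseq N : normc (Dker rho (Mseq m N)) = agree N * (Mseq m N)%:R.
Proof. by rewrite Dker_Mseq -natrM normc_nat natrM. Qed.

Lemma normc_Fker_Mseq j : normc (Fker rho (Mseq m j)) <= Phi j.
Proof.
elim: j => [|j IH] /=.
  rewrite /Fker big_ord1 /chi big_ord0 subn0 mulr1.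
  by rewrite ComplexField.Normc.normc1.
have := @FkerE rho j (m j) 0 (Mseq_gt0 hm2 j); rewrite !addn0 -MseqS => ->//.
rewrite {2}/Fker big_ord0 mulr0 addr0.
under eq_bigr do rewrite mulrDr.
rewrite big_split /= -mulr_suml.
apply: le_trans (normcD_le _ _) _; apply: lerD.
- apply: le_trans (normc_sum _ _ _) _.
  have -> : B%:R ^+ 2 * (Mseq m j)%:R ^+ 2 * agree j =
    B%:R * (B%:R * (Mseq m j)%:R * (agree j * (Mseq m j)%:R)) :> R by ring.
  apply: (@le_trans _ _ (\sum_(i < m j) (B%:R * (Mseq m j)%:R * (agree j * (Mseq m j)%:R)))).
    apply: ler_sum => b _; rewrite !ComplexField.Normc.normcM normc_nat normc_Dker_Mseq.
    rewrite -[leRHS]mul1r; apply: ler_pM; rewrite ?normc_ge0 ?normc_exp_le1//.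
      by rewrite mulr_ge0 ?mulr_ge0 ?agree_ge0.
    apply: ler_wpM2r; first by rewrite mulr_ge0 ?agree_ge0.
    rewrite -natrM ler_nat; apply: leq_trans (leq_subr _ _) _.
    by rewrite leq_mul2r hB orbT.
  rewrite sumr_const card_ord -[leLHS]mulr_natl; apply: ler_wpM2r; last by rewrite ler_nat.
  by rewrite !mulr_ge0 ?agree_ge0.
- rewrite ComplexField.Normc.normcM; apply: ler_pM; rewrite ?normc_ge0//.
  have [Ej|Ej] := boolP (E j).
    rewrite rhoE//; under eq_bigr do rewrite expr1n.
    by rewrite sumr_const card_ord normc_nat mul1r.
  by rewrite rhoN// ComplexField.Normc.normc0 mul0r.
Qed.

Definition Psi N : R := \sum_(j < N.+1) (B%:R ^+ 2 * (Mseq m j)%:R ^+ 2 * agree j + B%:R * Phi j).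

(** Each application of [step] strips the leading digit and leaves the kernel of order [k %% M_K];
    descending to level 0 produces the sum [Psi]. The geometric sums over [b < a] are incomplete
    here and do not cancel, so [Phi] is multiplied by [B] only. *)
Lemma normc_Fker N n : (n <= Mseq m N.+1)%N -> normc (Fker rho n) <= Psi N.
Proof.
have step K k : (k <= Mseq m K.+1)%N -> normc (Fker rho k) <=
    B%:R ^+ 2 * (Mseq m K)%:R ^+ 2 * agree K + B%:R * Phi K
    + normc (Fker rho (k %% Mseq m K)).
  move=> kM; have M0 := Mseq_gt0 hm2 K.
  have kE := divn_eq k (Mseq m K).
  rewrite {1}kE FkerE ?ltn_mod// -?kE//.
  have aB : (k %/ Mseq m K <= B)%N.
    apply: leq_trans (hB K); rewrite -(leq_pmul2r M0).
    exact: leq_trans (leq_divM _ _) kM.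
  apply: le_trans (normcD_le _ _) _; apply: lerD; last first.
    by rewrite ComplexField.Normc.normcM ler_piMl ?normc_ge0 ?normc_exp_le1.
  apply: le_trans (normc_sum _ _ _) _.
  have -> : B%:R ^+ 2 * (Mseq m K)%:R ^+ 2 * agree K + B%:R * Phi K =
    B%:R * (B%:R * (Mseq m K)%:R * (agree K * (Mseq m K)%:R) + Phi K) :> R by ring.
  apply: (@le_trans _ _ (\sum_(i < k %/ Mseq m K)
      (B%:R * (Mseq m K)%:R * (agree K * (Mseq m K)%:R) + Phi K))).
    apply: ler_sum => b _; rewrite ComplexField.Normc.normcM.
    apply: le_trans (ler_piMl (normc_ge0 _) (normc_exp_le1 _ (rho1 K))) _.
    apply: le_trans (normcD_le _ _) _; apply: lerD; last exact: normc_Fker_Mseq.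
    rewrite ComplexField.Normc.normcM normc_nat normc_Dker_Mseq.
    apply: ler_wpM2r; first by rewrite mulr_ge0 ?agree_ge0.
    rewrite -natrM ler_nat; apply: leq_trans (leq_subr _ _) (leq_trans kM _).
    by rewrite MseqS leq_mul2r hB orbT.
  rewrite sumr_const card_ord -[leLHS]mulr_natl; apply: ler_wpM2r; last by rewrite ler_nat.
  by rewrite addr_ge0 ?Phi_ge0// !mulr_ge0 ?agree_ge0.
elim: N n => [|N IH] n nM; rewrite /Psi big_ord_recr /= -/(Psi _);
  apply: le_trans (step _ _ nM) _; rewrite [leLHS]addrC lerD2r.
  by rewrite modn1 /Fker !big_ord0 ComplexField.Normc.normc0.
apply: IH; exact/ltnW/ltn_pmod/Mseq_gt0.
Qed.

End Bounds.

End Kernel.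

(** * Subadditivity of the [p]-th power *)

Section PowR.
Context (R : realType) (p : R) (p0 : 0 < p) (p1 : p <= 1).
Implicit Types x y : R.

Lemma ler_powRp x y : 0 <= x -> x <= y -> x `^ p <= y `^ p.
Proof.
move=> x0 xy; apply: ge0_ler_powR; rewrite ?nnegrE ?(ltW p0)//.
exact: le_trans xy.
Qed.

(** After normalisation by [x + y], both fractions lie in [[0, 1]], where [z <= z^p], and they add
    up to 1. *)
Lemma powRD_le x y : 0 <= x -> 0 <= y -> (x + y) `^ p <= x `^ p + y `^ p.
Proof.
move=> x0 y0; have [xy0|xy0] := leP (x + y) 0.
  have -> : x = 0 by lra.
  have -> : y = 0 by lra.
  by rewrite addr0 lerDl powR_ge0.
have frac z : 0 <= z -> z <= x + y -> z / (x + y) <= (z / (x + y)) `^ p.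
  rewrite le_eqVlt => /orP[/eqP <- _|z0 zxy]; first by rewrite mul0r powR_ge0.
  by apply: ger1_powR => //; rewrite divr_gt0//= ler_pdivrMr// mul1r.
have split z : 0 <= z -> (z / (x + y)) `^ p * (x + y) `^ p = z `^ p.
  move=> z0; have sn : x + y != 0 by rewrite gt_eqF.
  by rewrite -powRM ?(divfK sn)// ?divr_ge0// ltW.
rewrite -(split x)// -(split y)// -mulrDl ler_peMl ?powR_ge0//.
apply: (@le_trans _ _ (x / (x + y) + y / (x + y))).
  by rewrite -mulrDl divff// gt_eqF.
by apply: lerD; apply: frac; lra.
Qed.

Lemma powR_sum_le I (r : seq I) (P : pred I) (G : I -> R) :
  (forall i, P i -> 0 <= G i) ->
  (\sum_(i <- r | P i) G i) `^ p <= \sum_(i <- r | P i) G i `^ p.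
Proof.
move=> G0; suff [] : 0 <= \sum_(i <- r | P i) G i /\
  (\sum_(i <- r | P i) G i) `^ p <= \sum_(i <- r | P i) G i `^ p by [].
elim/big_ind2: _ => [|x1 x2 y1 y2 [h0 h1] [h2 h3]|i Pi].
- by rewrite powR0// gt_eqF.
- split; first exact: addr_ge0.
  by apply: le_trans (powRD_le _ _) _ => //; exact: lerD.
- by split=> //; exact: G0.
Qed.

Lemma natr_powR (b : bool) : (b%:R : R) `^ p = b%:R.
Proof. by case: b; rewrite ?powR1 ?powR0// gt_eqF. Qed.

End PowR.

(** * Functions of finitely many coordinates and their averages *)

Definition level T (K : nat) (g : (nat -> nat) -> T) :=
  forall x y, (forall j, (j < K)%N -> x j = y j) -> g x = g y.

Lemma level_le T K L (g : (nat -> nat) -> T) : (K <= L)%N -> level K g -> level L g.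
Proof. by move=> KL h x y xy; apply: h => j jK; apply: xy; exact: leq_trans KL. Qed.

Section Average.
Context (R : realType) (m : nat -> nat) (hm2 : forall k, (2 <= m k)%N).

(* The points [digit m i], [i < M_K], represent the cylinders of length [K] in [G_m], so this is
   the integral of a function of the first [K] coordinates. *)
Definition avg K (g : (nat -> nat) -> R) : R :=
  (Mseq m K)%:R^-1 * \sum_(i < Mseq m K) g (digit m i).

Lemma MseqR_gt0 K : 0 < (Mseq m K)%:R :> R.
Proof. by rewrite ltr0n Mseq_gt0. Qed.

Lemma MseqR_ge1 K : 1 <= (Mseq m K)%:R :> R.
Proof. by rewrite ler1n Mseq_gt0. Qed.

Lemma mR_gt0 K : 0 < (m K)%:R :> R.
Proof. by rewrite ltr0n m_gt0. Qed.

Lemma sum_digitS (V : nmodType) K (g : (nat -> nat) -> V) : 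
  \sum_(i < Mseq m K.+1) g (digit m i) =
  \sum_(i < Mseq m K) \sum_(b < m K) g (digit m (i + b * Mseq m K)).
Proof. by rewrite MseqS (sum_block (fun i => g (digit m i))) exchange_big. Qed.

Lemma sum_digitS_level (V : nmodType) K (g : (nat -> nat) -> V) : level K g ->
  \sum_(i < Mseq m K.+1) g (digit m i) = (\sum_(i < Mseq m K) g (digit m i)) *+ m K.
Proof.
move=> gK; rewrite sum_digitS -sumrMnl; apply: eq_bigr => i _.
rewrite -[in RHS](card_ord (m K)) -sumr_const; apply: eq_bigr => b _.
by apply: gK => j jK; rewrite digitD_lt.
Qed.

Lemma avgS_level K g : level K g -> avg K.+1 g = avg K g.
Proof.
move=> gK; rewrite /avg sum_digitS_level// MseqS natrM invfM -[X in _ * X = _]mulr_natl.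
by rewrite mulrACA mulVf ?mul1r// gt_eqF ?mR_gt0.
Qed.

Lemma avg_level K L g : level K g -> (K <= L)%N -> avg L g = avg K g.
Proof.
move=> gK; elim: L => [|L IH]; first by rewrite leqn0 => /eqP ->.
rewrite leq_eqVlt => /orP[/eqP -> //|KL].
by rewrite avgS_level ?IH//; exact: level_le gK.
Qed.

Lemma avg_ge0 K g : (forall x, 0 <= g x) -> 0 <= avg K g.
Proof. by move=> g0; rewrite mulr_ge0 ?invr_ge0 ?sumr_ge0. Qed.

Lemma ler_avg K g h : (forall i, (i < Mseq m K)%N -> g (digit m i) <= h (digit m i)) ->
  avg K g <= avg K h.
Proof.
move=> gh; apply: ler_wpM2l; first by rewrite invr_ge0.
by apply: ler_sum => i _; exact: gh.
Qed.

Lemma avgD K g h : avg K (fun x => g x + h x) = avg K g + avg K h.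
Proof. by rewrite /avg big_split mulrDr. Qed.

Lemma avgZ K c g : avg K (fun x => c * g x) = c * avg K g.
Proof. by rewrite /avg -mulr_sumr mulrCA. Qed.

Lemma avg_sum K I (r : seq I) (P : pred I) (G : I -> (nat -> nat) -> R) :
  avg K (fun x => \sum_(i <- r | P i) G i x) = \sum_(i <- r | P i) avg K (G i).
Proof. by rewrite /avg exchange_big mulr_sumr. Qed.

(** * Moments of the kernel majorants *)

Section Kernel_moments.
Context (B : nat) (hB : forall k, (m k <= B)%N) (p : R) (p0 : 0 < p) (p1 : p < 1).
Context (t : nat -> nat) (ht : forall k, (t k < m k)%N).

Definition coincide (x : nat -> nat) : nat -> bool := fun k => x k == t k.

Lemma agreeS E j : agree R E j.+1 = agree R E j * (E j)%:R.
Proof. by rewrite /agree -addn1 iotaD all_cat /= andbT -natrM mulnb. Qed.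

Lemma agree_level j : level j (fun x => agree R (coincide x) j).
Proof.
move=> x y xy; rewrite /agree; congr (_%:R); congr nat_of_bool.
by apply: eq_in_all => k; rewrite mem_iota add0n => /andP[_ kj]; rewrite /coincide xy.
Qed.

Lemma Phi_level j : level j (fun x => Phi R m (coincide x) B j).
Proof.
elim: j => [//|j IH] x y xy /=.
have xy' k : (k < j)%N -> x k = y k by move=> /ltnW /xy.
rewrite (IH _ _ xy') (agree_level xy') {2}/coincide xy//.
Qed.

Lemma Psi_level N : level N (fun x => Psi R m (coincide x) B N).
Proof.
move=> x y xy; apply: eq_bigr => j _.
have xy' k : (k < j)%N -> x k = y k.
  by move=> kj; apply: xy; have := ltn_ord j; rewrite ltnS; exact: leq_trans.
by rewrite (Phi_level xy') (agree_level xy').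
Qed.

Lemma sum_eq_ord n (c : R) k : (k < n)%N -> \sum_(b < n) (b == k :> nat)%:R * c = c.
Proof.
move=> kn; rewrite (bigD1 (Ordinal kn)) //= eqxx mul1r big1 ?addr0// => b.
by rewrite -val_eqE /= => /negbTE ->; rewrite mul0r.
Qed.

(** Among the [m j] children of a cylinder of length [j], exactly one has [j]-th coordinate
    [t j]. *)
Lemma avg_mul_coincide j g : level j g ->
  avg j.+1 (fun x => g x * (coincide x j)%:R) = (m j)%:R^-1 * avg j g.
Proof.
move=> gj; rewrite /avg (sum_digitS _ (fun x => g x * (coincide x j)%:R)).
rewrite MseqS natrM invfM -mulrA; congr (_ * (_ * _)).
apply: eq_bigr => i _.
rewrite -[RHS](sum_eq_ord _ (ht j)); apply: eq_bigr => b _.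
rewrite mulrC /coincide digitD_eq//; congr (_ * _).
by apply: gj => k kj; rewrite digitD_lt.
Qed.

Lemma avg_agree j : avg j (fun x => agree R (coincide x) j) = (Mseq m j)%:R^-1.
Proof.
elim: j => [|j IH].
  by rewrite /avg /= big_ord1 /agree /= mulr1.
under [X in avg _ X]funext do rewrite agreeS.
by rewrite avg_mul_coincide ?IH; [rewrite MseqS natrM invfM|exact: agree_level].
Qed.

Definition Lam N : R := \sum_(j < N.+1) (Mseq m j)%:R `^ (2 * p - 1).

Lemma Lam_ge1 N : 1 <= Lam N.
Proof.
rewrite /Lam big_ord_recl /= powR1 lerDl; apply: sumr_ge0 => j _; exact: powR_ge0.
Qed.

Let c : R := (B%:R ^+ 2) `^ p.

(** A spike of height [M_j^2] on a set of measure [1/M_j]; this computation produces the summands of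
    [Lam]. *)
Lemma avg_agree_powR j : avg j (fun x =>
    (B%:R ^+ 2 * (Mseq m j)%:R ^+ 2 * agree R (coincide x) j) `^ p)
  = c * (Mseq m j)%:R `^ (2 * p - 1).
Proof.
have M0 := MseqR_gt0 j.
have -> : (fun x => (B%:R ^+ 2 * (Mseq m j)%:R ^+ 2 * agree R (coincide x) j) `^ p) =
    (fun x => (c * (Mseq m j)%:R `^ (2 * p)) * agree R (coincide x) j).
  apply/funext => x; rewrite -[(Mseq m j)%:R ^+ 2]powR_mulrn ?(ltW M0)//.
  rewrite (powRM _ (mulr_ge0 _ _)) ?exprn_ge0 ?powR_ge0 ?agree_ge0//.
  by rewrite (powRM _ (exprn_ge0 _ _)) ?powR_ge0// natr_powR// -powRrM.
rewrite avgZ avg_agree -mulrA powRB ?powRr1 ?(ltW M0)//.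
by rewrite (gt_eqF M0) implybT.
Qed.

Definition Phi_moment j : R := avg j (fun x => Phi R m (coincide x) B j `^ p).

Lemma Phi_moment_ge0 j : 0 <= Phi_moment j.
Proof. by apply: avg_ge0 => x; exact: powR_ge0. Qed.

(** The factor [m j] costs [m_j^p], while coincidence in the coordinate [j] has probability [1/m_j]
    independently of the earlier ones. Together they give [m_j^(p-1) <= 2^(p-1)], a contraction
    since [p < 1]. *)
Lemma Phi_momentS j :
  Phi_moment j.+1 <= c * (Mseq m j)%:R `^ (2 * p - 1) + 2 `^ (p - 1) * Phi_moment j.
Proof.
have m0 := mR_gt0 j.
apply: (@le_trans _ _ (avg j.+1 (fun x =>
   (B%:R ^+ 2 * (Mseq m j)%:R ^+ 2 * agree R (coincide x) j) `^ p +
   (m j)%:R `^ p * (Phi R m (coincide x) B j `^ p * (coincide x j)%:R)))).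
  apply: ler_avg => i _ /=; apply: le_trans (powRD_le (ltW p1) _ _) _.
  - by rewrite mulr_ge0 ?agree_ge0// mulr_ge0 ?exprn_ge0.
  - by rewrite mulr_ge0 ?Phi_ge0.
  - rewrite lerD2l powRM ?mulr_ge0 ?Phi_ge0// powRM// natr_powR//.
    by rewrite -mulrA mulrCA [X in _ * X <= _]mulrC.
rewrite avgD avgS_level; last by move=> x y xy; rewrite (agree_level xy).
rewrite avg_agree_powR lerD2l avgZ avg_mul_coincide; last first.
  by move=> x y xy; rewrite (Phi_level xy).
rewrite mulrA; apply: ler_wpM2r; first exact: Phi_moment_ge0.
rewrite -{2}(powRr1 (ltW m0)) -powRB ?(gt_eqF m0) ?implybT//.
rewrite -[p - 1]opprB !powRN lef_pV2 ?posrE ?powR_gt0//.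
by apply: ge0_ler_powR; rewrite ?nnegrE ?subr_ge0 ?(ltW p1)// ler_nat.
Qed.

(** Summing the recursion gives [S <= 1 + c Lam N + q S] with [q = 2^(p-1) < 1], and the last term
    is absorbed on the left. The 1 is the moment of [Phi 0] and is at most [Lam N]. *)
Lemma sum_Phi_moment N : \sum_(j < N.+1) Phi_moment j <=
  (1 + c) / (1 - 2 `^ (p - 1)) * Lam N.
Proof.
have q1 : 2 `^ (p - 1) < 1 :> R.
  rewrite -[p - 1]opprB powRN invf_lt1 ?powR_gt0//.
  have r0 : 0 < 1 - p by rewrite subr_gt0.
  by have := @gt0_ltr_powR R _ r0 1 2; rewrite powR1 !nnegrE; apply=> //; rewrite ltr1n.
set q := 2 `^ (p - 1) in q1 *; set S := \sum_(_ < _) _.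
have c0 : 0 <= c by exact: powR_ge0.
have S_le : S <= 1 + c * Lam N + q * S.
  rewrite {1}/S big_ord_recl -addrA; apply: lerD.
    by rewrite /Phi_moment /avg big_ord1 powR1 mulr1 invr1.
  apply: (@le_trans _ _ (\sum_(i < N) (c * (Mseq m i)%:R `^ (2 * p - 1) + q * Phi_moment i))).
    by apply: ler_sum => i _; exact: Phi_momentS.
  rewrite big_split /= -!mulr_sumr; apply: lerD; apply: ler_wpM2l; rewrite ?powR_ge0//.
    by rewrite /Lam big_ord_recr /= lerDl powR_ge0.
  by rewrite /S big_ord_recr/= lerDl Phi_moment_ge0.
rewrite mulrAC ler_pdivlMr ?subr_gt0//.
have := Lam_ge1 N; set L := Lam N in S_le * => L1; nra.
Qed.

Definition Psi_const : R := c + B%:R `^ p * ((1 + c) / (1 - 2 `^ (p - 1))).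

Lemma avg_Psi N : avg N (fun x => Psi R m (coincide x) B N `^ p) <= Psi_const * Lam N.
Proof.
apply: (@le_trans _ _ (avg N (fun x => \sum_(j < N.+1)
   ((B%:R ^+ 2 * (Mseq m j)%:R ^+ 2 * agree R (coincide x) j) `^ p
     + B%:R `^ p * Phi R m (coincide x) B j `^ p)))).
  apply: ler_avg => i _ /=.
  have a0 j : 0 <= B%:R ^+ 2 * (Mseq m j)%:R ^+ 2 * agree R (coincide (digit m i)) j.
    by rewrite mulr_ge0 ?agree_ge0// mulr_ge0 ?exprn_ge0.
  have b0 j : 0 <= B%:R * Phi R m (coincide (digit m i)) B j.
    by rewrite mulr_ge0 ?Phi_ge0.
  rewrite /Psi; apply: (le_trans (powR_sum_le p0 (ltW p1) _ _)) => [j _|].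
    exact: addr_ge0.
  apply: ler_sum => j _; apply: le_trans (powRD_le (ltW p1) _ _) _ => //.
  by rewrite (powRM _ (ler0n _ B)) ?Phi_ge0.
rewrite avg_sum.
under eq_bigr => j _.
  have jN : (j <= N)%N by rewrite -ltnS.
  rewrite avgD avgZ (@avg_level j N)//; last by move=> x y xy; rewrite (agree_level xy).
  rewrite (@avg_level j N (fun x => Phi R m (coincide x) B j `^ p))//; last first.
    by move=> x y xy; rewrite (Phi_level xy).
  rewrite avg_agree_powR -/(Phi_moment j).
  over.
rewrite big_split /= -!mulr_sumr -/(Lam N) mulrDl lerD2l -mulrA.
by apply: ler_wpM2l; rewrite ?powR_ge0// sum_Phi_moment.
Qed.

End Kernel_moments.
End Average.

(** * Characters and finite Fourier analysis *)

Section Vilenkin.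
Context (R : realType) (m : nat -> nat) (hm2 : forall k, (2 <= m k)%N).

Definition cis (a : R) : R[i] := Complex (cos a) (sin a).

Lemma cisD a b : cis (a + b) = cis a * cis b.
Proof. by rewrite /cis cosD sinD; simpc; congr Complex; ring. Qed.

Lemma cis0 : cis 0 = 1.
Proof. by rewrite /cis cos0 sin0. Qed.

Lemma cisN a : conjc (cis a) = cis (- a).
Proof. by rewrite /cis cosN sinN. Qed.

Lemma cisX a n : cis a ^+ n = cis (a *+ n).
Proof.
elim: n => [|n IH]; first by rewrite expr0 mulr0n cis0.
by rewrite exprS IH mulrS cisD.
Qed.

Lemma normc_cis a : normc (cis a) = 1.
Proof. by rewrite /= cos2Dsin2 sqrtr1. Qed.

Lemma cis_2pi_nat n : cis (2 * pi * n%:R) = 1.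
Proof.
rewrite mulr_natr -cisX; suff -> : cis (2 * pi) = 1 by rewrite expr1n.
by rewrite mulr_natl /cis cos2pi sin2pi.
Qed.

(** Half-angle formula: [cos a = 1 - 2 sin(a/2)^2], and the sine is positive on []0, pi[]. *)
Lemma cis_neq1 a : 0 < `|a| < 2 * pi -> cis a != 1.
Proof.
move=> /andP[a0 a2]; apply/eqP => -[] c1 _.
have c1' : cos `|a| = 1.
  by have [_|_] := ger0P a; rewrite ?cosN.
have : sin (`|a| / 2) > 0 by apply: sin_gt0_pi; rewrite divr_gt0//= ltr_pdivrMr// mulrC.
have : cos `|a| = 1 - 2 * sin (`|a| / 2) ^+ 2.
  have -> : `|a| = `|a| / 2 *+ 2 by rewrite -mulr_natr divfK.
  rewrite cos_mulr2n; have := cos2Dsin2 (`|a| / 2 *+ 2 / 2).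
  have -> : `|a| / 2 *+ 2 / 2 = `|a| / 2 by rewrite -mulr_natr divfK.
  by move=> h; rewrite -mulr_natr; nra.
rewrite c1' => h1 h2; nra.
Qed.

(** Orthogonality of the characters of [Z_k]: the ratio of this geometric sum is a [k]-th root of
    unity, different from 1 because [0 < |a - b| < k]. *)
Lemma sum_cis_eq0 (k a b : nat) : (a < k)%N -> (b < k)%N -> a != b ->
  \sum_(i < k) cis (2 * pi * a%:R / k%:R - 2 * pi * b%:R / k%:R) ^+ i = 0.
Proof.
move=> ak bk ab; set t := _ - _.
have k0 : 0 < k%:R :> R by rewrite ltr0n; lia.
have p0 := pi_gt0 R.
have tE : t = 2 * pi / k%:R * (a%:R - b%:R) by rewrite /t; ring.
have tk : t *+ k = 2 * pi * a%:R - 2 * pi * b%:R.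
  by rewrite tE -mulr_natr; field; rewrite gt_eqF.
have t1 : cis t - 1 != 0.
  rewrite subr_eq0; apply: cis_neq1; rewrite tE normrM gtr0_norm; last by rewrite divr_gt0 ?mulr_gt0.
  apply/andP; split.
    by rewrite mulr_gt0 ?divr_gt0 ?mulr_gt0 ?normr_gt0 ?subr_eq0 ?eqr_nat.
  rewrite mulrAC ltr_pdivrMr// ltr_pM2l ?mulr_gt0//.
  rewrite ltr_norml; have := ltr0n R b; have := ltr0n R a.
  have : (a%:R < k%:R :> R) by rewrite ltr_nat.
  have : (b%:R < k%:R :> R) by rewrite ltr_nat.
  have := ler0n R a; have := ler0n R b; lra.
apply: (mulfI t1); rewrite mulr0 -subrX1 cisX tk cisD -cisN !cis_2pi_nat.
by rewrite rmorph1 mulr1 subrr.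
Qed.

Lemma radE k x : rad m k x = cis (2 * pi * (x k)%:R / (m k)%:R).
Proof. by []. Qed.

Lemma psiE i x : psi m i x = chi m (fun k => rad m k x) i :> R[i].
Proof. by []. Qed.

Definition rho (x t : nat -> nat) (k : nat) : R[i] := rad m k x * conjc (rad m k t).

Lemma psi_conj i x t : psi m i x * conjc (psi m i t) = chi m (rho x t) i.
Proof.
rewrite /psi /chi rmorph_prod -big_split /=; apply: eq_bigr => k _.
by rewrite rmorphXn exprMn.
Qed.

Lemma rhoE x t k : rho x t k =
  cis (2 * pi * (x k)%:R / (m k)%:R - 2 * pi * (t k)%:R / (m k)%:R).
Proof. by rewrite /rho !radE cisN cisD. Qed.

Lemma normc_rho x t k : normc (rho x t k) <= 1.
Proof. by rewrite rhoE normc_cis. Qed.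

Lemma rho_coincide x t k : coincide t x k -> rho x t k = 1.
Proof. by rewrite rhoE => /eqP ->; rewrite subrr cis0. Qed.

Lemma Gm_set_digit i : Gm_set m (digit m i).
Proof. by move=> k; rewrite digit_lt. Qed.

Lemma rho_sum0 x t : Gm_set m x -> Gm_set m t -> forall k, ~~ coincide t x k ->
  \sum_(b < m k) rho x t k ^+ b = 0.
Proof. by move=> hx ht k xt; rewrite rhoE sum_cis_eq0. Qed.

Lemma psi_level K i : (i < Mseq m K)%N -> level K (@psi R m i).
Proof.
move=> iK x y xy; rewrite !psiE !(chiE hm2 _ iK); apply: eq_bigr => k _.
by rewrite !radE xy.
Qed.

Definition avgC K (g : (nat -> nat) -> R[i]) : R[i] :=
  (Mseq m K)%:R^-1 * \sum_(i < Mseq m K) g (digit m i).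

Definition coef K (g : (nat -> nat) -> R[i]) (i : nat) : R[i] :=
  avgC K (fun t => g t * conjc (psi m i t)).

(** This is [n] times the [n]-th Fejer mean of [g], with coefficients computed on level [K]; by
    [FconvE] it is the convolution of [g] with [Fker]. *)
Definition Fconv K (g : (nat -> nat) -> R[i]) (n : nat) (x : nat -> nat) : R[i] :=
  \sum_(i < n) (n - i)%:R * (coef K g i * psi m i x).

Lemma MseqC_neq0 K : (Mseq m K)%:R != 0 :> R[i].
Proof. by rewrite pnatr_eq0 -lt0n Mseq_gt0. Qed.

Lemma coef_sum K g n (w : nat -> R[i]) x : \sum_(i < n) w i * (coef K g i * psi m i x) =
  avgC K (fun t => g t * \sum_(i < n) w i * chi m (rho x t) i).
Proof.
rewrite /coef /avgC [RHS]mulr_sumr; under [RHS]eq_bigr do rewrite 2!mulr_sumr.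
rewrite [RHS]exchange_big /=; apply: eq_bigr => i _.
rewrite mulr_sumr mulr_suml mulr_sumr; apply: eq_bigr => j _.
by rewrite -psi_conj; ring.
Qed.

Lemma FconvE K g n x : Fconv K g n x = avgC K (fun t => g t * Fker m (rho x t) n).
Proof. exact: (coef_sum K g n (fun i => (n - i)%:R)). Qed.

Lemma normc_avgC K g : normc (avgC K g) <= avg m K (fun x => normc (g x)).
Proof.
rewrite /avgC /avg ComplexField.Normc.normcM ComplexField.Normc.normcV normc_nat.
by apply: ler_wpM2l; rewrite ?invr_ge0// normc_sum.
Qed.

(** The Dirichlet kernel of order [M_K] vanishes at every representative except the one sharing the
    first [K] coordinates of [x], where its value [M_K] cancels the normalisation. *)
Lemma Fourier_inversion K g x : level K g -> Gm_set m x ->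
  \sum_(i < Mseq m K) coef K g i * psi m i x = g x.
Proof.
move=> gK hx; under eq_bigr do rewrite -[_ * _]mul1r.
rewrite (coef_sum _ _ _ (fun=> 1)) /avgC.
have DE (l : nat) : \sum_(i < Mseq m K) 1 * chi m (rho x (digit m l)) i =
    (all (coincide (digit m l) x) (iota 0 K))%:R * (Mseq m K)%:R :> R[i].
  under eq_bigr do rewrite mul1r.
  exact: (Dker_Mseq hm2 (@rho_coincide _ _) (rho_sum0 hx (Gm_set_digit l))).
have [j jK hj] := digits_surj hm2 (fun k (_ : (k < K)%N) => hx k).
under eq_bigr => l _ do rewrite DE.
rewrite (bigD1 (Ordinal jK)) //= [X in _ + X]big1 ?addr0 => [|i ij].
- have -> : all (coincide (digit m j) x) (iota 0 K).
    by apply/allP => k; rewrite mem_iota add0n => /andP[_ kK]; rewrite /coincide hj.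
  by rewrite mul1r mulrCA mulVf ?mulr1 ?MseqC_neq0//; exact: gK.
- case: (boolP (all _ _)) => [/allP al|_]; last by rewrite mul0r mulr0.
  case/eqP: ij; apply: val_inj; apply: (digits_inj hm2 (ltn_ord i) jK) => k kK.
  have := al k; rewrite mem_iota add0n => /(_ kK) /eqP <-.
  by rewrite hj.
Qed.

(** For [i < M_K] the character is constant on cylinders of length [K], so only the sums of [h] over
    the children of a cylinder matter. *)
Lemma coefS K g h i : level K g ->
  (forall j, (j < Mseq m K)%N -> g (digit m j) *+ m K =
     \sum_(b < m K) h (digit m (j + b * Mseq m K))) ->
  (i < Mseq m K)%N -> coef K.+1 h i = coef K g i.
Proof.
move=> gK gh iK; rewrite /coef /avgC.
rewrite (sum_digitS _ _ (fun t => h t * conjc (psi m i t))) MseqS natrM invfM.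
have mK : (m K)%:R != 0 :> R[i] by rewrite pnatr_eq0 -lt0n m_gt0.
rewrite mulrC mulrA -[RHS]mulrC; congr (_ * _).
rewrite mulr_suml; apply: eq_bigr => j _.
apply: (mulIf mK); rewrite mulfVK// mulrAC mulr_natr gh//.
rewrite mulr_suml; apply: eq_bigr => b _; congr (_ * conjc _).
by apply: (psi_level iK) => k kK; rewrite digitD_lt.
Qed.

Lemma coef_level K g i : level K g -> (i < Mseq m K)%N -> coef K.+1 g i = coef K g i.
Proof.
move=> gK; apply: coefS => // j _.
rewrite -[in LHS](card_ord (m K)) -sumr_const; apply: eq_bigr => b _.
by apply: gK => k kK; rewrite digitD_lt.
Qed.

(** Such an [i] has a nonzero digit [b] in position [K], so the sum over the [K]-th coordinate of
    [t], on which [g] does not depend, is a vanishing character sum. *)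
Lemma coef_high K g i : level K g -> (Mseq m K <= i < Mseq m K.+1)%N ->
  coef K.+1 g i = 0.
Proof.
move=> gK /andP[Ki iK]; rewrite /coef /avgC.
rewrite (sum_digitS _ _ (fun t => g t * conjc (psi m i t))).
rewrite big1 ?mulr0// => j _.
pose b := (i %/ Mseq m K)%N.
have M0 := Mseq_gt0 hm2 K.
have bm : (b < m K)%N by rewrite ltn_divLR.
have iE : i = (i %% Mseq m K + b * Mseq m K)%N by rewrite addnC -divn_eq.
have b0 : b != 0%N by rewrite -lt0n divn_gt0.
rewrite (eq_bigr (fun a : 'I_(m K) => g (digit m j) *
   conjc (psi m (i %% Mseq m K) (digit m j)) *
   cis (2 * pi * 0%:R / (m K)%:R - 2 * pi * b%:R / (m K)%:R) ^+ a)); last first.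
  move=> a _; rewrite -mulrA; congr (_ * _).
    by apply: gK => k kK; rewrite digitD_lt.
  rewrite psiE [X in chi _ _ X]iE chiD ?ltn_mod// mulrC rmorphM.
  congr (_ * _).
    congr conjc; rewrite -psiE; apply: (@psi_level K); rewrite ?ltn_mod// => k kK.
    by rewrite digitD_lt.
  rewrite radE digitD_eq// cisX [LHS]cisN cisX; congr cis.
  by rewrite -/b mulr0 mul0r sub0r mulNrn; congr (- _);
    rewrite -[LHS]mulr_natr -[RHS]mulr_natr; ring.
by rewrite -mulr_sumr sum_cis_eq0 ?mulr0 ?m_gt0// eq_sym.
Qed.

Section Key.
Context (B : nat) (hB : forall k, (m k <= B)%N) (p : R) (p0 : 0 < p) (p1 : p < 1).

(** The convolution is a mean over the [M = M_(K+1)] representatives. Subadditivity gives [M^(-p)]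
    times a sum of [M] terms, that is [M^(1-p)] times an average. The majorant [Psi] at [K] does not
    see the last coordinate, so its moment is the one of level [K]. *)
Lemma Fconv_moment K d n : (n <= Mseq m K.+1)%N ->
  avg m K.+1 (fun x => normc (Fconv K.+1 d n x) `^ p) <=
  Psi_const B p * Lam m p K * (Mseq m K.+1)%:R `^ (1 - p) *
  avg m K.+1 (fun x => normc (d x) `^ p).
Proof.
move=> nM; have M0 := @MseqR_gt0 R m hm2 K.+1; set M := Mseq m K.+1 in M0 *.
pose G t x := normc (d t) `^ p * Psi R m (coincide t x) B K `^ p.
apply: (@le_trans _ _ (avg m K.+1 (fun x =>
   M%:R^-1 `^ p * \sum_(i < M) G (digit m i) x))).
  apply: ler_avg => l _; set x := digit m l.
  rewrite FconvE.
  apply: (@le_trans _ _ ((M%:R^-1 * \sum_(i < M) normc (d (digit m i)) *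
      Psi R m (coincide (digit m i) x) B K) `^ p)).
    apply: ler_powRp => //; first exact: normc_ge0.
    apply: le_trans (normc_avgC _ _) _.
    apply: ler_wpM2l; first by rewrite invr_ge0 ltW.
    apply: ler_sum => i _; rewrite ComplexField.Normc.normcM.
    apply: ler_wpM2l; first exact: normc_ge0.
    apply: normc_Fker => //; first exact: normc_rho.
      exact: rho_coincide.
    by apply: rho_sum0; exact: Gm_set_digit.
  have Psi0 t : 0 <= Psi R m (coincide t x) B K.
    by apply: sumr_ge0 => j _; rewrite addr_ge0 ?mulr_ge0 ?exprn_ge0 ?agree_ge0 ?Phi_ge0.
  rewrite powRM ?invr_ge0 ?(ltW M0)//; last first.
    by apply: sumr_ge0 => i _; rewrite mulr_ge0 ?normc_ge0.
  apply: ler_wpM2l; first exact: powR_ge0.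
  apply: le_trans (powR_sum_le p0 (ltW p1) _ _) _ => [i _|].
    by rewrite mulr_ge0 ?normc_ge0.
  by apply: ler_sum => i _; rewrite /G powRM ?normc_ge0.
rewrite avgZ avg_sum.
apply: (@le_trans _ _ (M%:R^-1 `^ p * \sum_(i < M)
    normc (d (digit m i)) `^ p * (Psi_const B p * Lam m p K))).
  apply: ler_wpM2l; first exact: powR_ge0.
  apply: ler_sum => i _; rewrite avgZ; apply: ler_wpM2l; first exact: powR_ge0.
  rewrite avgS_level//; last by move=> x y xy; congr (_ `^ _); exact: Psi_level.
  by apply: avg_Psi => // k; rewrite digit_lt.
rewrite -mulr_suml /avg -/M le_eqVlt; apply/orP; left; apply/eqP.
have -> : M%:R^-1 `^ p = (M%:R `^ p)^-1 :> R.
  by rewrite -powR_inv1 ?(ltW M0)// -powRrM mulN1r powRN.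
rewrite powRB ?powRr1 ?(ltW M0)// ?(gt_eqF M0) ?implybT//.
have := powR_gt0 p M0; set q := _ `^ p; set S := \sum_(_ < _) _ => q0.
by field; rewrite !gt_eqF.
Qed.

End Key.
End Vilenkin.

(** * Geometric convolution of a null sequence *)

Definition eventually_small (R : realType) (u : nat -> R) :=
  forall eps : R, 0 < eps -> exists J, forall j, (J <= j)%N -> u j <= eps.

Definition geom_conv (R : realType) (q : R) (u : nat -> R) N : R :=
  \sum_(j < N.+1) q ^+ (N - j) * u j.

Lemma geom_convS (R : realType) (q : R) u N :
  geom_conv q u N.+1 = q * geom_conv q u N + u N.+1.
Proof.
rewrite /geom_conv big_ord_recr /= subnn expr0 mul1r; congr (_ + _).
rewrite mulr_sumr; apply: eq_bigr => j _.
by rewrite subSn ?exprS ?mulrA// -ltnS.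
Qed.

(** Once [u <= (1 - q) eps/2], the value [eps/2] is a supersolution of the recursion [geom_convS],
    and the contribution of the past [geom_conv q u J] decays like [q^k]. *)
Lemma geom_conv_small (R : realType) (q : R) u : 0 <= q < 1 -> (forall j, 0 <= u j) ->
  eventually_small u -> eventually_small (geom_conv q u).
Proof.
move=> /andP[q0 q1] u0 hu eps e0.
have q1' : 0 < 1 - q by rewrite subr_gt0.
have e2 : 0 < eps / 2 by rewrite divr_gt0.
have [J hJ] := hu (eps / 2 * (1 - q)) (mulr_gt0 e2 q1').
have step k : geom_conv q u (J + k) <= q ^+ k * geom_conv q u J + eps / 2.
  elim: k => [|k IH]; first by rewrite addn0 expr0 mul1r lerDl divr_ge0// ltW.
  rewrite addnS geom_convS exprS.
  have h1 := ler_wpM2l q0 IH.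
  have h2 := hJ (J + k).+1 (leq_trans (leq_addr _ _) (leqnSn _)).
  apply: le_trans (lerD h1 h2) _; rewrite le_eqVlt; apply/orP; left; apply/eqP.
  by field.
have [k hk] : exists k, q ^+ k * geom_conv q u J <= eps / 2.
  have S0 : 0 <= geom_conv q u J.
    by apply: sumr_ge0 => j _; rewrite mulr_ge0 ?exprn_ge0.
  have /cvgrPdist_le/(_ (eps / 2 / (1 + geom_conv q u J))) : q ^+ n @[n --> \oo] --> 0.
    by apply: cvg_expr; rewrite ger0_norm.
  case; first by rewrite divr_gt0 ?divr_gt0// ltr_wpDr.
  move=> k _ /(_ k (leqnn k)) /=; rewrite sub0r normrN ger0_norm ?exprn_ge0// => h.
  exists k; have := ler_wpM2r S0 h => /le_trans; apply.
  rewrite mulrAC ler_pdivrMr ?ltr_wpDr//; apply: ler_wpM2l; last by rewrite lerDr.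
  by rewrite divr_ge0// ltW.
have qk l : (k <= l)%N -> q ^+ l * geom_conv q u J <= eps / 2.
  move=> kl; apply: le_trans hk; apply: ler_wpM2r.
    by apply: sumr_ge0 => j _; rewrite mulr_ge0 ?exprn_ge0.
  by apply: ler_wiXn2l; rewrite ?(ltW q1).
exists (J + k)%N => j jJ.
have -> : j = (J + (j - J))%N by lia.
have kj : (k <= j - J)%N by lia.
apply: le_trans (step _) _; have := qk _ kj; lra.
Qed.

(** * Fejer means of a martingale on finite levels *)

Section DiscreteMartingale.
Context (R : realType) (m : nat -> nat) (hm2 : forall k, (2 <= m k)%N).
Context (f : nat -> (nat -> nat) -> R[i]) (fl : forall k, level k (f k)).
Hypothesis fm : forall k j, (j < Mseq m k)%N ->
  f k (digit m j) *+ m k = \sum_(b < m k) f k.+1 (digit m (j + b * Mseq m k)).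

(** Level [i] already determines the [i]-th coefficient, because [i < M_i]. *)
Definition mcoef i : R[i] := coef m i (f i) i.

Lemma coef_mcoef K i : (i < Mseq m K)%N -> coef m K (f K) i = mcoef i.
Proof.
have stable L K' : (K' <= L)%N -> (i < Mseq m K')%N ->
    coef m L (f L) i = coef m K' (f K') i.
  move=> + iK; elim: L => [|L IH]; first by rewrite leqn0 => /eqP ->.
  rewrite leq_eqVlt => /orP[/eqP -> //|KL].
  rewrite (@coefS _ _ hm2 L (f L))// ?IH//; first exact: fm.
  exact: ltn_Mseq_le iK KL.
move=> iK; rewrite /mcoef; have [iK'|/ltnW Ki] := leqP i K.
  by rewrite -(stable K i)// ltn_Mseq.
by rewrite (stable i K).
Qed.

Definition mdiff K x := f K.+1 x - f K x.

Lemma mdiff_level K : level K.+1 (mdiff K).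
Proof.
by move=> x y xy; rewrite /mdiff (fl xy) (level_le (leqnSn K) (@fl K) xy).
Qed.

(** Below [M_K] the martingale property makes the coefficients of [f K.+1] and [f K] cancel; from
    [M_K] on, [f K] has none. *)
Lemma coef_mdiff K i : (i < Mseq m K.+1)%N ->
  coef m K.+1 (mdiff K) i = if (i < Mseq m K)%N then 0 else mcoef i.
Proof.
move=> iK; have -> : coef m K.+1 (mdiff K) i = coef m K.+1 (f K.+1) i - coef m K.+1 (f K) i.
  rewrite /coef /avgC -mulrBr -sumrB; congr (_ * _); apply: eq_bigr => j _.
  by rewrite -mulrBl.
rewrite coef_mcoef//; case: ltnP => iK'.
  by rewrite coef_level// coef_mcoef// subrr.
by rewrite coef_high ?subr0// iK' iK.
Qed.

Definition fejer_sum n x : R[i] := \sum_(i < n) (n - i)%:R * (mcoef i * psi m i x).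

Definition fejer_gap K x := fejer_sum (Mseq m K) x - (Mseq m K)%:R * f K x.

Lemma mart_inversion K x : Gm_set m x -> \sum_(i < Mseq m K) mcoef i * psi m i x = f K x.
Proof.
move=> hx; rewrite -[RHS](Fourier_inversion hm2 (@fl K) hx).
by apply: eq_bigr => i _; rewrite coef_mcoef.
Qed.

(** For [i < M_K] the weight [(n - i) - n = - i] does not depend on [n], so the low frequencies
    contribute exactly [fejer_gap K]. The frequencies from [M_K] to [n] are those of [mdiff K]. *)
Lemma fejer_sum_split K n x : Gm_set m x -> (Mseq m K <= n <= Mseq m K.+1)%N ->
  fejer_sum n x - n%:R * f K x = Fconv m K.+1 (mdiff K) n x + fejer_gap K x.
Proof.
move=> hx /andP[Kn nK].
have -> : Fconv m K.+1 (mdiff K) n x =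
   fejer_sum n x - \sum_(i < Mseq m K) (n - i)%:R * (mcoef i * psi m i x).
  rewrite /Fconv /fejer_sum -(subnKC Kn) !big_split_ord /=.
  rewrite big1 => [|i _]; last first.
    rewrite coef_mdiff ?ltn_ord ?mul0r ?mulr0//.
    exact: ltn_Mseq_le (ltn_ord i) (leqnSn K).
  rewrite addrAC subrr; congr (_ + _); apply: eq_bigr => i _.
  rewrite coef_mdiff; last by have := ltn_ord i; lia.
  by rewrite ltnNge leq_addr.
rewrite -addrA; congr (_ + _); rewrite /fejer_gap /fejer_sum -(mart_inversion K hx) !mulr_sumr.
rewrite -!sumrN -!big_split /=.
apply: eq_bigr => i _; rewrite !natrB; first ring.
  exact: ltnW.
by apply: leq_trans Kn; exact: ltnW.
Qed.

(** The case [n = M_(K+1)] of [fejer_sum_split], after [f K] is traded for [f K.+1]. *)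
Lemma fejer_gapS K x : Gm_set m x -> fejer_gap K.+1 x =
  Fconv m K.+1 (mdiff K) (Mseq m K.+1) x + fejer_gap K x
  - (Mseq m K.+1)%:R * mdiff K x.
Proof.
move=> hx; rewrite -fejer_sum_split//; last by rewrite leqnn (Mseq_le hm2).
by rewrite /fejer_gap /mdiff; ring.
Qed.

Lemma fejer_gap0 x : Gm_set m x -> fejer_gap 0 x = 0.
Proof.
move=> hx; rewrite /fejer_gap /fejer_sum -(mart_inversion 0 hx) /= !big_ord1.
by rewrite subn0 subrr.
Qed.

Lemma fejer_gap_level K : level K (fejer_gap K).
Proof.
move=> x y xy; rewrite /fejer_gap /fejer_sum (fl xy); congr (_ - _).
by apply: eq_bigr => i _; rewrite (psi_level R hm2 (ltn_ord i) xy).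
Qed.

Section Moments.
Context (B : nat) (hB : forall k, (m k <= B)%N) (p : R) (p0 : 0 < p) (p2 : p <= 2^-1).

Let p1 : p < 1.
Proof. by apply: le_lt_trans p2 _; rewrite invf_lt1// ltr1n. Qed.

Definition dmoment K : R := avg m K.+1 (fun x => normc (mdiff K x) `^ p).

Lemma dmoment_ge0 K : 0 <= dmoment K.
Proof. by apply: avg_ge0 => x; exact: powR_ge0. Qed.

(** The two summands bound the moments of the two new terms in [fejer_gapS]: the convolution and the
    multiple of [mdiff K]. *)
Definition block_bound K : R :=
  (Psi_const B p * Lam m p K * (Mseq m K.+1)%:R `^ (1 - p) + (Mseq m K.+1)%:R `^ p)
  * dmoment K.

Lemma normc_powRD (z w : R[i]) : normc (z + w) `^ p <= normc z `^ p + normc w `^ p.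
Proof.
apply: le_trans (powRD_le (ltW p1) (normc_ge0 z) (normc_ge0 w)).
by apply: ler_powRp (normcD_le _ _) => //; exact: normc_ge0.
Qed.

Lemma fejer_gap_moment K :
  avg m K (fun x => normc (fejer_gap K x) `^ p) <= \sum_(j < K) block_bound j.
Proof.
elim: K => [|K IH].
  rewrite big_ord0 /avg big1 ?mulr0// => i _.
  rewrite fejer_gap0; last exact: Gm_set_digit.
  by rewrite ComplexField.Normc.normc0 powR0// gt_eqF.
rewrite big_ord_recr /=.
apply: (@le_trans _ _ (avg m K.+1 (fun x => normc (fejer_gap K x) `^ p +
   (normc (Fconv m K.+1 (mdiff K) (Mseq m K.+1) x) `^ p +
   (Mseq m K.+1)%:R `^ p * normc (mdiff K x) `^ p)))).
  apply: ler_avg => i _; rewrite fejer_gapS; last exact: Gm_set_digit.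
  apply: le_trans (normc_powRD _ _) _.
  rewrite normcN ComplexField.Normc.normcM normc_nat powRM ?normc_ge0// [leRHS]addrA lerD2r.
  by rewrite [leRHS]addrC; exact: normc_powRD.
rewrite !avgD avgZ avgS_level//; last first.
  by move=> x y xy; rewrite (fejer_gap_level xy).
apply: lerD IH _; rewrite /block_bound mulrDl lerD2r.
exact: Fconv_moment.
Qed.

Lemma fejer_sum_moment N n : (Mseq m N <= n <= Mseq m N.+1)%N ->
  avg m N.+1 (fun x => normc (fejer_sum n x - n%:R * f N x) `^ p) <=
  \sum_(j < N.+1) block_bound j.
Proof.
move=> hn; rewrite big_ord_recr /= addrC.
apply: (@le_trans _ _ (avg m N.+1 (fun x =>
   normc (Fconv m N.+1 (mdiff N) n x) `^ p + normc (fejer_gap N x) `^ p))).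
  apply: ler_avg => i _; rewrite fejer_sum_split//; last exact: Gm_set_digit.
  exact: normc_powRD.
have /andP[_ nN] := hn.
rewrite avgD (@avgS_level _ _ hm2 N (fun x => normc (fejer_gap N x) `^ p)); last first.
  by move=> x y xy; rewrite (fejer_gap_level xy).
apply: lerD (fejer_gap_moment N).
apply: le_trans (Fconv_moment hm2 hB p0 p1 (mdiff N) nN) _.
by rewrite -/(dmoment N) /block_bound [leRHS]mulrDl lerDl mulr_ge0 ?powR_ge0 ?dmoment_ge0.
Qed.

Definition wmoment K : R := Lam m p K * (Mseq m K)%:R `^ (1 - 2 * p) * dmoment K.

Lemma wmoment_ge0 K : 0 <= wmoment K.
Proof.
apply: mulr_ge0 (dmoment_ge0 K); apply: mulr_ge0 (powR_ge0 _ _).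
exact: le_trans ler01 (Lam_ge1 _ _ _).
Qed.

Definition block_const : R := Psi_const B p * B%:R `^ (1 - p) + B%:R `^ p.

Lemma Psi_const_ge0 : 0 <= Psi_const B p.
Proof.
rewrite /Psi_const; apply: addr_ge0; first exact: powR_ge0.
apply: mulr_ge0; first exact: powR_ge0.
apply: divr_ge0; first by rewrite addr_ge0 ?powR_ge0.
rewrite subr_ge0 -[p - 1]opprB powRN invf_le1 ?powR_gt0//.
have := @ler_powR R 2 _ 0 (1 - p); rewrite powRr0; apply; rewrite ?ler1n//.
by rewrite subr_ge0 ltW.
Qed.

(** In the first summand [M^(1-p) = M^p M^(1-2p)]. The second is absorbed because [Lam >= 1] and
    [M^(1-2p) >= 1], the latter by [p <= 1/2]. The power [M^p] is set aside for the division by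
    [n^p]. *)
Lemma block_bound_le K : block_bound K <= block_const * (Mseq m K)%:R `^ p * wmoment K.
Proof.
rewrite /block_bound /wmoment /block_const.
have M1 := @MseqR_ge1 R m hm2 K; have M0 := @MseqR_gt0 R m hm2 K.
have L1 := Lam_ge1 m p K; have d0 := dmoment_ge0 K; have C0 := Psi_const_ge0.
rewrite MseqS natrM !powRM//; set M := (Mseq m K)%:R in M1 M0 *.
have hb1 : (m K)%:R `^ (1 - p) <= B%:R `^ (1 - p) :> R.
  by apply: ge0_ler_powR; rewrite ?nnegrE ?subr_ge0 ?(ltW p1)// ler_nat.
have hb2 : (m K)%:R `^ p <= B%:R `^ p :> R.
  by apply: ge0_ler_powR; rewrite ?nnegrE ?(ltW p0)// ler_nat.
have Mp : M `^ (1 - p) = M `^ p * M `^ (1 - 2 * p).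
  by rewrite -powRD; [congr (_ `^ _); ring|rewrite (gt_eqF M0) implybT].
have M12 : 1 <= M `^ (1 - 2 * p).
  have := @ler_powR R M M1 0 (1 - 2 * p); rewrite powRr0; apply.
  by move: p2; lra.
have h0 := powR_ge0 M p.
have h1 := powR_ge0 (m K)%:R (1 - p); have h2 := powR_ge0 (m K)%:R p.
rewrite Mp.
set X := M `^ p in h0 *; set Y := M `^ (1 - 2 * p) in M12 *.
set L := Lam _ _ _ in L1 *.
rewrite mulrDl [in leRHS]mulrDl mulrDl; apply: lerD.
  have -> : Psi_const B p * L * ((m K)%:R `^ (1 - p) * (X * Y)) * dmoment K =
     Psi_const B p * (m K)%:R `^ (1 - p) * X * (L * Y * dmoment K) by ring.
  have Y0 : 0 <= Y by lra.
  have L0 : 0 <= L by lra.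
  have Z0 : 0 <= L * Y * dmoment K := mulr_ge0 (mulr_ge0 L0 Y0) d0.
  apply: (ler_wpM2r Z0); apply: (ler_wpM2r h0); exact: (ler_wpM2l C0).
have LY : 1 <= L * Y by nra.
apply: (ler_pM (mulr_ge0 h2 h0) d0 (ler_wpM2r h0 hb2)).
by rewrite ler_peMl.
Qed.

(** The geometric weights come from [n > M_N >= 2^(N-j) M_j], which gives
    [(M_j/n)^p <= 2^(-p(N-j))]. *)
Lemma fejer_moment N n : (Mseq m N < n <= Mseq m N.+1)%N ->
  avg m N.+1 (fun x => normc (n%:R^-1 * fejer_sum n x - f N x) `^ p) <=
  block_const * geom_conv (2^-1 `^ p) wmoment N.
Proof.
move=> /andP[nN nN']; have M0 := @MseqR_gt0 R m hm2 N.
have n0 : 0 < n%:R :> R by apply: lt_trans M0 _; rewrite ltr_nat.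
have n0' : n%:R != 0 :> R[i] by rewrite pnatr_eq0; case: (n) nN.
rewrite (_ : (fun x => _) = (fun x => n%:R^-1 `^ p *
    normc (fejer_sum n x - n%:R * f N x) `^ p)); last first.
  have nZ (z : R[i]) : n%:R^-1 * normc z = normc (n%:R^-1 * z).
    by rewrite ComplexField.Normc.normcM ComplexField.Normc.normcV normc_nat.
  by apply/funext => x; rewrite -powRM ?normc_ge0 ?invr_ge0// nZ mulrBr mulKf.
rewrite avgZ.
apply: le_trans (ler_wpM2l (powR_ge0 _ _) (fejer_sum_moment _)) _.
  by rewrite (ltnW nN).
rewrite /geom_conv !mulr_sumr; apply: ler_sum => j _.
have jN : (j <= N)%N by rewrite -ltnS.
apply: le_trans (ler_wpM2l (powR_ge0 _ _) (block_bound_le _)) _.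
rewrite -[X in _ * X <= _]mulrA mulrCA; apply: ler_wpM2l.
  by rewrite addr_ge0 ?mulr_ge0 ?powR_ge0 ?Psi_const_ge0.
rewrite mulrA; apply: ler_wpM2r; first exact: wmoment_ge0.
rewrite -powRM ?invr_ge0 ?(ltW n0)//.
rewrite -powR_mulrn ?powR_ge0// powRAC powR_mulrn ?invr_ge0//.
apply: ler_powRp => //.
rewrite exprVn mulrC ler_pdivrMr// mulrC ler_pdivlMr ?exprn_gt0//.
rewrite -natrX -natrM ler_nat mulnC; apply: leq_trans (ltnW nN).
by have := leq_pow2_Mseq hm2 j (N - j); rewrite subnKC.
Qed.

End Moments.
End DiscreteMartingale.


(** * Haar measure on functions of finitely many coordinates *)

Lemma cyl_measurable n a : measurable (cyl n a : set Gm).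
Proof. by apply: sub_sigma_algebra; exists n, a. Qed.

Lemma cyl_level n a : level n (cyl n a).
Proof.
move=> x y xy; rewrite /cyl /=; apply/propext.
by split=> h j jn; [rewrite -xy|rewrite xy]; rewrite ?h.
Qed.

Lemma indic_cyl_level (V : pzRingType) n K a : (n <= K)%N ->
  level K (fun x => \1_(cyl n a) x : V).
Proof.
move=> nK x y xy; rewrite !indicE; congr (_%:R); congr nat_of_bool.
apply/idP/idP; rewrite !inE;
  by rewrite (cyl_level a (fun j jn => xy j (leq_trans jn nK))).
Qed.

(** Coordinates in the carrier are unbounded, so infinitely many cylinders of length [K] may be
    needed; they are indexed by finite sequences, hence countably many. *)
Lemma level_measurable_set K (A : set Gm) : level K A -> measurable A.
Proof.
move=> AK; pose F (s : seq nat) := [set x | cyl K (nth 0%N s) x /\ A (nth 0%N s)].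
have -> : A = \bigcup_k F (odflt [::] (unpickle k)).
  apply/seteqP; split => [x Ax|x [k _]].
    have xE j : (j < K)%N -> nth 0%N (mkseq x K) j = x j by move=> jK; rewrite nth_mkseq.
    exists (pickle (mkseq x K)) => //; rewrite pickleK; split.
      by move=> j jK; rewrite xE.
    by rewrite (AK _ x).
  by set s := odflt _ _ => -[xs As]; rewrite (AK _ (nth 0%N s)).
apply: bigcupT_measurable => k; set s := odflt _ _.
have [As|As] := pselect (A (nth 0%N s)).
  rewrite (_ : F s = cyl K (nth 0%N s)); first exact: cyl_measurable.
  by apply/seteqP; split => x //= [].
rewrite (_ : F s = set0); first exact: measurable0.
by apply/seteqP; split => x //= [].
Qed.

Lemma level_comp T U K (h : T -> U) (g : (nat -> nat) -> T) :
  level K g -> level K (fun x => h (g x)).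
Proof. by move=> gK x y xy; rewrite (gK x y). Qed.

Lemma level_comp2 T1 T2 U K (h : T1 -> T2 -> U) (g1 : (nat -> nat) -> T1)
    (g2 : (nat -> nat) -> T2) :
  level K g1 -> level K g2 -> level K (fun x => h (g1 x) (g2 x)).
Proof. by move=> h1 h2 x y xy; rewrite (h1 x y)// (h2 x y). Qed.

Lemma level_measurable_fun d (T : sigmaRingType d) K (g : Gm -> T) :
  level K g -> measurable_fun [set: Gm] g.
Proof.
move=> gK _ Y mY; rewrite setTI; apply: (@level_measurable_set K).
exact: (level_comp Y gK).
Qed.

Lemma level_measurable_EFin (R : realType) K (g : Gm -> R) :
  level K g -> measurable_fun [set: Gm] (fun x => (g x)%:E).
Proof.
move=> gK; refine (@level_measurable_fun _ _ K _ _).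
exact: (level_comp EFin gK).
Qed.

Section Haar.
Context (R : realType) (m : nat -> nat) (hm2 : forall k, (2 <= m k)%N).
Context (mu : {measure set Gm -> \bar R}) (hmu : is_Haar m mu).

(** A point outside [G_m] has an inadmissible coordinate [k], so its cylinder of length [k+1] is
    null; there are only countably many such cylinders. *)
Lemma ae_Gm_set : {ae mu, forall x, Gm_set m x}.
Proof.
pose F (s : seq nat) : set Gm := if [forall j : 'I_(size s), nth 0%N s j < m j]%N then set0
  else cyl (size s) (nth 0%N s).
have FN s : mu.-negligible (F s).
  rewrite /F; case: ifPn => h; first exact: negligible_set0.
  exists (cyl (size s) (nth 0%N s)); split => //; first exact: cyl_measurable.
  by rewrite hmu (negbTE h).
have : mu.-negligible (\bigcup_k F (odflt [::] (unpickle k))).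
  by apply: negligible_bigcup => k; exact: FN.
apply: negligibleS => x /existsNP[k /negP xk].
exists (pickle (mkseq x k.+1)) => //; rewrite pickleK /F size_mkseq.
case: ifPn => [/forallP/(_ (Ordinal (ltnSn k)))|_ j jk].
  by rewrite nth_mkseq// (negbTE xk).
by rewrite nth_mkseq.
Qed.

Lemma mu_cyl_digit K i : mu (cyl K (digit m i)) = ((Mseq m K)%:R^-1)%:E.
Proof. by rewrite hmu; case: ifPn => // /forallP[] j; rewrite digit_lt. Qed.

Lemma mu_cyl_point K x : Gm_set m x -> mu (cyl K x) = ((Mseq m K)%:R^-1)%:E.
Proof. by move=> hx; rewrite hmu; case: ifPn => // /forallP[] j; exact: hx. Qed.

Lemma cyl_sum_eq (V : pzRingType) K (G : nat -> V) x j : (j < Mseq m K)%N ->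
  (forall k, (k < K)%N -> digit m j k = x k) ->
  \sum_(i < Mseq m K) G i * \1_(cyl K (digit m i)) x = G j.
Proof.
move=> jK hj; rewrite (bigD1 (Ordinal jK)) //= indicE mem_set ?mulr1; last first.
  by move=> k kK; rewrite hj.
rewrite big1 ?addr0// => i ij; rewrite indicE memNset ?mulr0// => hi.
case/eqP: ij; apply: val_inj; apply: (digits_inj hm2 (ltn_ord i) jK) => k kK.
by rewrite hj// hi.
Qed.

Lemma integrable_cyl K i :
  mu.-integrable [set: Gm] (fun x => (\1_(cyl K (digit m i)) x)%:E).
Proof.
have mcyl : measurable (cyl K (digit m i) : set Gm) := cyl_measurable _ _.
apply/integrableP; split.
  exact: (level_measurable_EFin (indic_cyl_level _ _ (leqnn K))).
rewrite (eq_integral (fun x : Gm => (\1_(cyl K (digit m i)) x)%:E)); last first.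
  by move=> x _; rewrite gee0_abs// lee_fin.
by rewrite integral_indic// setIT mu_cyl_digit ltry.
Qed.

(** Bridge from the measure to finite averages: on [G_m], hence a.e., [g] equals the simple function
    [h] with its values at the representatives, and each of their cylinders has mass [1/M_K]. *)
Lemma integral_level K (g : Gm -> R) : level K g ->
  (\int[mu]_x (g x)%:E)%E = (avg m K g)%:E.
Proof.
move=> gK.
pose h x := \sum_(i < Mseq m K) g (digit m i) * \1_(cyl K (digit m i)) x.
have hK : level K h.
  by move=> x y xy; apply: eq_bigr => i _; rewrite (indic_cyl_level _ _ (leqnn K) xy).
rewrite (@ae_eq_integral _ _ _ mu setT (fun x => (h x)%:E)) //; first last.
- apply: (@filterS _ _ (ae_filter_ringOfSetsType mu) _ _ _ ae_Gm_set) => x hx _.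
  have [j jK hj] := digits_surj hm2 (fun k (_ : (k < K)%N) => hx k).
  have -> : h x = g (digit m j) := cyl_sum_eq (fun i => g (digit m i)) jK hj.
  by congr (_%:E); apply: gK => k kK; rewrite hj.
- exact: (level_measurable_EFin hK).
- exact: (level_measurable_EFin gK).
rewrite (eq_integral (fun x : Gm => \sum_(i < Mseq m K)
    (g (digit m i))%:E * (\1_(cyl K (digit m i)) x)%:E)%E); last first.
  by move=> x _; rewrite /h -sumEFin; apply: eq_bigr => i _; exact: EFinM.
have mcyl i : measurable (cyl K (digit m i) : set Gm) := cyl_measurable _ _.
rewrite integral_sum// => [|i]; last by apply: integrableZl => //; exact: integrable_cyl.
rewrite /avg mulr_sumr -sumEFin; apply: eq_bigr => i _.
rewrite integralZl//; last exact: integrable_cyl.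
by rewrite integral_indic// setIT mu_cyl_digit -EFinM mulrC.
Qed.

Lemma integral_level_cyl K n a (g : Gm -> R) : level K g -> (n <= K)%N ->
  (\int[mu]_(x in cyl n a) (g x)%:E)%E = (avg m K (fun x => g x * \1_(cyl n a) x))%:E.
Proof.
move=> gK nK; rewrite integral_mkcond.
rewrite -(@integral_level K (fun x => g x * \1_(cyl n a) x)).
  apply: eq_integral => x _; rewrite patchE indicE; case: ifP => _.
    by rewrite mulr1.
  by rewrite mulr0.
by move=> x y xy; rewrite (gK x y)// (indic_cyl_level _ _ nK xy).
Qed.

End Haar.

(** * Martingales, Fourier coefficients and Fejer means in finite terms *)

Section MartingaleHaar.
Context (R : realType) (m : nat -> nat) (hm2 : forall k, (2 <= m k)%N).
Context (mu : {measure set Gm -> \bar R}) (hmu : is_Haar m mu).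

Lemma indic_cyl_sym (V : pzRingType) n (x y z : nat -> nat) :
  (forall k, (k < n)%N -> z k = y k) -> \1_(cyl n x) z = \1_(cyl n y) x :> V.
Proof.
move=> zy; rewrite !indicE; congr (_%:R); congr nat_of_bool.
apply/idP/idP; rewrite !inE => h k kn; first by rewrite -zy// h.
by rewrite zy// h.
Qed.

(** Both integrals become averages. [indic_cyl_sym] moves the indicator onto the fixed point
    [digit m j], so that [cyl_sum_eq] isolates one cylinder; cancelling its mass leaves the identity
    over the children. *)
Lemma sum_children K j (g h : Gm -> R) : level K g -> level K.+1 h ->
  (j < Mseq m K)%N ->
  (\int[mu]_(x in cyl K (digit m j)) (h x)%:E =
   \int[mu]_(x in cyl K (digit m j)) (g x)%:E)%E ->
  g (digit m j) *+ m K = \sum_(b < m K) h (digit m (j + b * Mseq m K)).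
Proof.
move=> gK hK jK.
rewrite (integral_level_cyl hm2 hmu _ hK)// (integral_level_cyl hm2 hmu _ gK)// => -[].
have cylE (G : nat -> R) : \sum_(i < Mseq m K) G i * \1_(cyl K (digit m i)) (digit m j) = G j :> R.
  exact: (cyl_sum_eq hm2 G jK).
rewrite /avg (sum_digitS m K (fun x => h x * \1_(cyl K (digit m j)) x)) MseqS natrM invfM.
under eq_bigr => i _.
  under eq_bigr => b _.
    rewrite (@indic_cyl_sym _ K _ (digit m i)) => [|k kK]; last by rewrite digitD_lt.
    over.
  rewrite -mulr_suml.
  over.
rewrite (cylE (fun i => \sum_(b < m K) h (digit m (i + b * Mseq m K)))).
under [X in _ = _ * X]eq_bigr => i _ do rewrite (@indic_cyl_sym _ K _ (digit m i))//.
rewrite (cylE (fun i => g (digit m i))) => e.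
have M0 := @MseqR_gt0 R m hm2 K; have m0 := @mR_gt0 R m hm2 K.
apply: (mulfI (invr_neq0 (lt0r_neq0 M0))); rewrite mulrnAr -e -mulr_natl.
set S := \sum_(_ < _) _; field.
by rewrite !gt_eqF.
Qed.

Section Martingale.
Context (f : nat -> Gm -> R[i]) (hf : is_martingale mu f).

Lemma martingale_level k : level k (f k).
Proof. by case: hf => h _; exact: h. Qed.

Lemma martingale_children k j : (j < Mseq m k)%N ->
  f k (digit m j) *+ m k = \sum_(b < m k) f k.+1 (digit m (j + b * Mseq m k)).
Proof.
move=> jk; have [_ /(_ k (digit m j)) [hRe hIm]] := hf.
have lk := @martingale_level k; have lk1 := @martingale_level k.+1.
have h1 := sum_children (level_comp (@complex.Re R) lk) (level_comp (@complex.Re R) lk1) jk hRe.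
have h2 := sum_children (level_comp (@complex.Im R) lk) (level_comp (@complex.Im R) lk1) jk hIm.
by apply/eqP; rewrite eq_complex !raddfMn !raddf_sum /= h1 h2 !eqxx.
Qed.

Lemma Re_natVM k (z : R[i]) : complex.Re (k%:R^-1 * z) = k%:R^-1 * complex.Re z.
Proof.
rewrite -(rmorph_nat (real_complex R)) -fmorphV; case: z => a b /=.
by rewrite mul0r subr0.
Qed.

Lemma Im_natVM k (z : R[i]) : complex.Im (k%:R^-1 * z) = k%:R^-1 * complex.Im z.
Proof.
rewrite -(rmorph_nat (real_complex R)) -fmorphV; case: z => a b /=.
by rewrite mul0r addr0.
Qed.

Lemma Re_avgC K (g : Gm -> R[i]) :
  complex.Re (avgC m K g) = avg m K (fun t => complex.Re (g t)).
Proof. by rewrite /avgC /avg Re_natVM raddf_sum. Qed.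

Lemma Im_avgC K (g : Gm -> R[i]) :
  complex.Im (avgC m K g) = avg m K (fun t => complex.Im (g t)).
Proof. by rewrite /avgC /avg Im_natVM raddf_sum. Qed.

Lemma Rintegral_level K (g : Gm -> R) : level K g ->
  Rintegral mu setT g = avg m K g.
Proof. by move=> gK; rewrite /Rintegral (integral_level hm2 hmu gK). Qed.

(** The sequence under the limit is constant from [k = i] on, since [i < M_i]. *)
Lemma fourierE i : fourier m mu f i = mcoef m f i.
Proof.
rewrite /fourier.
have lev k : (i <= k)%N -> level k (fun x => f k x * (psi m i x)^*).
  move=> ik; apply: level_comp2; first exact: martingale_level.
  apply: (level_comp (@conjc R)); apply: psi_level => //.
  exact: ltn_Mseq_le (ltn_Mseq hm2 i) ik.
have eqc k : (i <= k)%N -> avgC m k (fun x => f k x * (psi m i x)^*) = mcoef m f i.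
  move=> ik; apply: (coef_mcoef hm2 martingale_level martingale_children).
  exact: ltn_Mseq_le (ltn_Mseq hm2 i) ik.
case: (mcoef m f i) eqc => a b eqc.
congr Complex; apply: lim_near_cst => //; exists i => // k /= ik.
  by rewrite (Rintegral_level (level_comp (@complex.Re R) (lev k ik))) -Re_avgC eqc.
by rewrite (Rintegral_level (level_comp (@complex.Im R) (lev k ik))) -Im_avgC eqc.
Qed.

Lemma SpartE n x : Spart m mu f n x = \sum_(i < n) mcoef m f i * psi m i x.
Proof. by apply: eq_bigr => i _; rewrite fourierE. Qed.

(** Frequency [i] occurs in [S_k] for [i < k <= n], that is [n - i] times. *)
Lemma fejerE n x : fejer m mu f n x = n%:R^-1 * fejer_sum m f n x.
Proof.
rewrite /fejer /fejer_sum; congr (_ * _).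
elim: n => [|n IH]; first by rewrite big_geq// big_ord0.
rewrite big_nat_recr //= IH SpartE !big_ord_recr /= subSnn mul1r addrA; congr (_ + _).
rewrite -big_split /=; apply: eq_bigr => i _.
by rewrite subSn ?(ltnW (ltn_ord i))// -[_.+1]addn1 natrD mulrDl mul1r.
Qed.

Lemma Spart_Mseq N x : Gm_set m x -> Spart m mu f (Mseq m N) x = f N x.
Proof.
by move=> hx; rewrite SpartE (mart_inversion hm2 martingale_level martingale_children).
Qed.

Lemma Spart_level N : level N (Spart m mu f (Mseq m N)).
Proof.
move=> x y xy; rewrite !SpartE; apply: eq_bigr => i _.
by rewrite (psi_level R hm2 (ltn_ord i) xy).
Qed.

End Martingale.
End MartingaleHaar.

(** * The tail maximal function and the modulus of continuity *)

Lemma le_poweR (R : realType) (r : R) (x y : \bar R) :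
  0 <= r -> (0 <= x)%E -> (x <= y)%E -> (x `^ r <= y `^ r)%E.
Proof.
move=> r0 x0 xy; apply: gt0_ler_poweR => //; rewrite in_itv /= leey andbT//.
exact: le_trans xy.
Qed.

Lemma Lnorm_poweR d (T : measurableType d) (R : realType) (nu : {measure set T -> \bar R})
    (p : R) (g : T -> \bar R) : p != 0 ->
  (Lnorm nu p%:E g `^ p = \int[nu]_x (`|g x| `^ p))%E.
Proof.
move=> p0; rewrite unlock -poweRrM mulVf// poweRe1//.
by apply: integral_ge0 => x _; exact: poweR_ge0.
Qed.

Section TailMaximal.
Context (R : realType) (m : nat -> nat) (hm2 : forall k, (2 <= m k)%N).
Context (mu : {measure set Gm -> \bar R}) (hmu : is_Haar m mu).
Context (f : nat -> Gm -> R[i]) (hf : is_martingale mu f).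
Context (p : R) (p0 : 0 < p).

Definition tailmax N (x : Gm) : \bar R := esups (fun k => (normc (f k x - f N x))%:E) N.

Lemma tailmax_ub N k x : (N <= k)%N -> ((normc (f k x - f N x))%:E <= tailmax N x)%E.
Proof. by move=> Nk; apply: ereal_sup_ubound; exists k. Qed.

Lemma tailmax_ge0 N x : (0 <= tailmax N x)%E.
Proof.
apply: le_trans (tailmax_ub x (leqnn N)); rewrite lee_fin; exact: normc_ge0.
Qed.

Lemma tailmax_measurable N : measurable_fun [set: Gm] (tailmax N).
Proof.
apply: (@measurable_fun_esups _ _ _ _ (fun k x => (normc (f k x - f N x))%:E)) => k.
apply: (@level_measurable_EFin _ (maxn k N)) => x y xy.
by rewrite !(martingale_level hf (k:=k) (x:=x) (y:=y))
  ?(martingale_level hf (k:=N) (x:=x) (y:=y))// => j jk; apply: xy;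
  rewrite (leq_trans jk) ?leq_maxl ?leq_maxr.
Qed.

Lemma condexp_of_level k K (g : Gm -> R[i]) x : level K g -> (K <= k)%N -> Gm_set m x ->
  condexp mu k g x = g x.
Proof.
move=> gK Kk hx; have mcyl : measurable (cyl k x : set Gm) := cyl_measurable _ _.
have M0 := @MseqR_gt0 R m hm2 k.
have cst (h : Gm -> R) : level K h ->
    (fine (mu (cyl k x)))^-1 * Rintegral mu (cyl k x) h = h x.
  move=> hK; rewrite /Rintegral (eq_integral (cst (h x)%:E)); last first.
    move=> y; rewrite inE => xy /=; congr (_%:E); apply: hK => j jK.
    by apply: xy; exact: leq_trans Kk.
  rewrite integral_cst// (mu_cyl_point hmu)//= mulrCA mulVf ?mulr1//.
  by rewrite invr_neq0// gt_eqF.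
rewrite /condexp (cst _ (level_comp (@complex.Re R) gK)) (cst _ (level_comp (@complex.Im R) gK)).
by case: (g x).
Qed.

Lemma condexp_level k (g : Gm -> R[i]) : level k (condexp mu k g).
Proof.
move=> x y xy; rewrite /condexp; suff -> : cyl k x = cyl k y by [].
by apply/seteqP; split => z /= h j jk; rewrite h// xy.
Qed.

Definition modmart N k x := f k x - condexp mu k (Spart m mu f (Mseq m N)) x.

(** For [k >= N] conditioning fixes [S_(M_N) f], which is [f N] on [G_m], so these terms of
    [modmart N] are [f k - f N]; the terms with [k < N] can only enlarge the supremum. *)
Lemma tailmax_le_maxfun N x : Gm_set m x -> (tailmax N x <= maxfun (modmart N) x)%E.
Proof.
move=> hx; apply: ge_ereal_sup => _ [k Nk <-]; apply: ereal_sup_ubound; exists k => //.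
rewrite /modmart (condexp_of_level (Spart_level hm2 hmu hf (N:=N)))//.
by rewrite (Spart_Mseq hm2 hmu hf).
Qed.

Lemma maxfun_modmart_measurable N : measurable_fun [set: Gm] (maxfun (modmart N)).
Proof.
rewrite (_ : maxfun _ = fun x => esups (fun k => (normc (modmart N k x))%:E) 0); last first.
  by apply/funext => x; congr ereal_sup; apply/seteqP; split => y [k _ <-]; exists k.
apply: (@measurable_fun_esups _ _ _ _ (fun k x => (normc (modmart N k x))%:E)) => k.
apply: (@level_measurable_EFin _ k) => x y xy.
by rewrite /modmart (martingale_level hf xy) (condexp_level _ xy).
Qed.

Lemma maxfun_ge0 (g : nat -> Gm -> R[i]) x : (0 <= maxfun g x)%E.
Proof.
apply: (@le_trans _ _ (normc (g 0%N x))%:E); first by rewrite lee_fin normc_ge0.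
by apply: ereal_sup_ubound; exists 0%N.
Qed.

Lemma tailmax_moment N :
  (\int[mu]_x (tailmax N x `^ p) <= modcont m mu p f N `^ p)%E.
Proof.
rewrite Lnorm_poweR ?gt_eqF//.
apply: ae_ge0_le_integral => //.
- by move=> x _; exact: poweR_ge0.
- exact: measurableT_comp (measurable_poweR p) (tailmax_measurable N).
- by move=> x _; exact: poweR_ge0.
- apply: measurableT_comp (measurable_poweR p) _.
  exact: measurableT_comp (maxfun_modmart_measurable N).
apply: (@filterS _ _ (ae_filter_ringOfSetsType mu) _ _ _ (ae_Gm_set hmu)) => x hx _.
apply: le_poweR; [exact: ltW|exact: tailmax_ge0|].
rewrite gee0_abs ?maxfun_ge0//; exact: tailmax_le_maxfun.
Qed.

(** The difference [mdiff f N] is the term [k = N+1] of the tail maximal function. *)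
Lemma dmoment_le_modcont N : ((dmoment m f p N)%:E <= modcont m mu p f N `^ p)%E.
Proof.
apply: le_trans (tailmax_moment N).
have lev : level N.+1 (fun x => normc (mdiff f N x) `^ p).
  exact: (level_comp (fun z => normc z `^ p) (mdiff_level (martingale_level hf) (K:=N))).
rewrite /dmoment -(integral_level hm2 hmu lev).
apply: ge0_le_integral => //.
- by move=> x _; rewrite lee_fin powR_ge0.
- exact: level_measurable_EFin lev.
- exact: measurableT_comp (measurable_poweR p) (tailmax_measurable N).
move=> x _; rewrite -poweR_EFin; apply: le_poweR; first exact: ltW.
  by rewrite lee_fin normc_ge0.
exact: tailmax_ub.
Qed.

End TailMaximal.

(** * Comparison of integrals without measurability *)

Section Domination.
Context d (T : measurableType d) (R : realType) (nu : {measure set T -> \bar R}).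
Implicit Types g h : T -> \bar R.

(** The integral of a nonnegative function is a supremum over the simple functions below it, and
    this supremum is monotone whether or not the function is measurable. *)
Lemma le_integral_nonmeas g h : (forall x, 0 <= g x)%E -> (forall x, g x <= h x)%E ->
  (\int[nu]_x g x <= \int[nu]_x h x)%E.
Proof.
move=> g0 gh; have h0 x : (0 <= h x)%E by exact: le_trans (gh x).
rewrite !ge0_integralTE//; apply: ge_ereal_sup => _ [s /= sg <-].
by apply: ereal_sup_ubound; exists s => // x; exact: le_trans (gh x).
Qed.

(* [g] itself need not be measurable: it is dominated by [h] corrected to be infinite on a null set. *)
Lemma ae_le_integral_nonmeas g h : (forall x, 0 <= g x)%E -> (forall x, 0 <= h x)%E ->
  measurable_fun [set: T] h -> {ae nu, forall x, (g x <= h x)%E} ->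
  (\int[nu]_x g x <= \int[nu]_x h x)%E.
Proof.
move=> g0 h0 mh [N [mN N0 gN]].
pose c := (cst +oo%E : T -> \bar R) \_ N.
have c0 x : (0 <= c x)%E by rewrite /c patchE; case: ifP => // _; rewrite leey.
have mc : measurable_fun [set: T] c by apply/(measurable_restrictT _ mN); exact: measurable_cst.
apply: (@le_trans _ _ (\int[nu]_x (h x + c x))%E).
  apply: le_integral_nonmeas => // x.
  have [xN|xN] := pselect (N x).
    by rewrite /c patchE mem_set//= addey ?leey// gt_eqF// (lt_le_trans _ (h0 x)) ?ltNy0.
  apply: (@le_trans _ _ (h x)); last by rewrite leeDl.
  by apply: contrapT => /gN.
rewrite ge0_integralD// [X in (_ + X)%E](_ : _ = 0%E) ?adde0//.
by rewrite -integral_mkcond integral_cst// N0 mule0.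
Qed.

End Domination.

Lemma nneg_cvge0 (R : realType) (u : nat -> \bar R) : (forall n, 0 <= u n)%E ->
  (forall eps : R, 0 < eps -> \forall n \near \oo, (u n <= eps%:E)%E) -> u @ \oo --> 0%E.
Proof.
move=> u0 hu; have fin n (e : R) : (u n <= e%:E)%E -> u n \is a fin_num.
  by move=> h; rewrite ge0_fin_numE//; apply: le_lt_trans h _; rewrite ltry.
apply/fine_cvgP; split.
  by near=> n; apply: (@fin n 1); near: n; exact: hu.
apply/cvgrPdist_le => e e0; near=> n.
have h : (u n <= e%:E)%E by near: n; exact: hu.
rewrite sub0r normrN /= ger0_norm ?fine_ge0//.
by rewrite -lee_fin fineK// (fin n e).
Unshelve. all: by end_near. Qed.

Section ReIm.
Context (R : realType).

Lemma normc_le_ReIm (z : R[i]) : normc z <= `|complex.Re z| + `|complex.Im z|.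
Proof.
case: z => a b /=; rewrite -[leRHS]ger0_norm ?addr_ge0// -sqrtr_sqr.
rewrite ler_sqrt ?sqr_ge0// sqrrD !real_normK ?num_real// lerD2r lerDl.
by rewrite mulrn_wge0// mulr_ge0.
Qed.

Lemma Re_le_normc (z : R[i]) : `|complex.Re z| <= normc z.
Proof. by case: z => a b /=; rewrite -sqrtr_sqr ler_sqrt ?addr_ge0 ?sqr_ge0// lerDl sqr_ge0. Qed.

Lemma Im_le_normc (z : R[i]) : `|complex.Im z| <= normc z.
Proof. by case: z => a b /=; rewrite -sqrtr_sqr ler_sqrt ?addr_ge0 ?sqr_ge0// lerDr sqr_ge0. Qed.

End ReIm.

(** * Almost everywhere convergence of the martingale *)

Section PointwiseLimit.
Context (R : realType) (f : nat -> Gm -> R[i]).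

Definition tail_vanishing x := forall eps : R, 0 < eps -> exists N, (tailmax f N x <= eps%:E)%E.

Lemma cauchy_seq_cvg (u : nat -> R) :
  (forall eps, 0 < eps -> exists N, forall k, (N <= k)%N -> `|u k - u N| < eps) -> cvgn u.
Proof.
move=> hu; apply: cauchy_cvg; apply: cauchy_exP => e e0.
have [N hN] := hu _ e0; exists (u N); exists N => // k Nk.
by rewrite /= -ball_normE /= distrC hN.
Qed.

(** A single small tail for each [eps] makes the real and imaginary parts Cauchy, so the [limn] in
    [mart_lim] are genuine limits. Then [f k] is interposed between [f N] and the limit. *)
Lemma mart_lim_tailmax x N : tail_vanishing x ->
  ((normc (f N x - mart_lim f x))%:E <= tailmax f N x)%E.
Proof.
move=> hx.
have small eps : 0 < eps -> exists N, forall k, (N <= k)%N -> normc (f k x - f N x) < eps.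
  move=> e0; have [L hL] := hx (eps / 2) (divr_gt0 e0 (ltr0n _ 2)).
  exists L => k Lk; apply: le_lt_trans (_ : eps / 2 < eps); last by lra.
  by rewrite -lee_fin; apply: le_trans hL; exact: tailmax_ub.
have cRe : cvgn (fun k => complex.Re (f k x)).
  apply: cauchy_seq_cvg => e e0; have [L hL] := small _ e0; exists L => k Lk.
  by apply: le_lt_trans (hL k Lk); rewrite -raddfB; exact: Re_le_normc.
have cIm : cvgn (fun k => complex.Im (f k x)).
  apply: cauchy_seq_cvg => e e0; have [L hL] := small _ e0; exists L => k Lk.
  by apply: le_lt_trans (hL k Lk); rewrite -raddfB; exact: Im_le_normc.
have : (0 <= tailmax f N x)%E by exact: tailmax_ge0.
have : forall k, (N <= k)%N -> ((normc (f k x - f N x))%:E <= tailmax f N x)%E.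
  by move=> k; exact: tailmax_ub.
case: (tailmax f N x) => [c|_ _|_]; [|by rewrite leey|by rewrite leeNy_eq].
move=> hc _; rewrite lee_fin; apply/ler_addgt0Pl => e e0.
have e2 : 0 < e / 2 by rewrite divr_gt0.
have [k [Nk hRe hIm]] : exists k, [/\ (N <= k)%N,
    `|limn (fun k => complex.Re (f k x)) - complex.Re (f k x)| <= e / 2 &
    `|limn (fun k => complex.Im (f k x)) - complex.Im (f k x)| <= e / 2].
  have /cvgrPdist_le/(_ _ e2)[a _ ha] := cRe.
  have /cvgrPdist_le/(_ _ e2)[b _ hb] := cIm.
  exists (maxn N (maxn a b)); split; first exact: leq_maxl.
    by apply: ha; rewrite /= !leq_max leqnn orbT.
  by apply: hb; rewrite /= !leq_max leqnn !orbT.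
rewrite -normcN opprB.
have -> : mart_lim f x - f N x = (mart_lim f x - f k x) + (f k x - f N x).
  by rewrite addrA subrK.
apply: le_trans (normcD_le _ _) _; apply: lerD; last by rewrite -lee_fin hc.
apply: le_trans (normc_le_ReIm _) _; rewrite !raddfB /=; lra.
Qed.

End PointwiseLimit.

Section AlmostEverywhere.
Context (R : realType) (m : nat -> nat) (hm2 : forall k, (2 <= m k)%N).
Context (mu : {measure set Gm -> \bar R}) (hmu : is_Haar m mu).
Context (f : nat -> Gm -> R[i]) (hf : is_martingale mu f).
Context (p : R) (p0 : 0 < p).

(** The infimum over [N] of the tail maximal functions has [p]-th moment below every [modcont^p],
    hence moment 0, hence it vanishes almost everywhere. *)
Lemma ae_tail_vanishing :
  (forall eps : R, 0 < eps -> exists N, (modcont m mu p f N `^ p <= eps%:E)%E) ->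
  {ae mu, forall x, tail_vanishing f x}.
Proof.
move=> hmod; pose g x := einfs (fun N => tailmax f N x) 0.
have g_le N x : (g x <= tailmax f N x)%E by apply: ereal_inf_lbound; exists N.
have g0 x : (0 <= g x)%E by apply: le_ereal_inf_tmp => _ [N _ <-]; exact: tailmax_ge0.
have mg : measurable_fun [set: Gm] g.
  by apply: (@measurable_fun_einfs _ _ _ _ (tailmax f)) => N; exact: (tailmax_measurable hf).
have mgp : measurable_fun [set: Gm] (fun x => g x `^ p)%E.
  exact: measurableT_comp (measurable_poweR p) mg.
have : (\int[mu]_x `|g x `^ p|)%E = 0%E.
  rewrite (eq_integral (fun x => g x `^ p)%E); last first.
    by move=> x _; rewrite gee0_abs ?poweR_ge0.
  apply/eqP; rewrite eq_le integral_ge0 ?andbT => [|x _]; last exact: poweR_ge0.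
  apply/lee_addgt0Pr => e e0; rewrite add0e.
  have [N hN] := hmod _ e0; apply: le_trans hN.
  apply: le_trans (tailmax_moment hm2 hmu hf p0 N).
  apply: le_integral_nonmeas => x; first exact: poweR_ge0.
  by apply: le_poweR => //; exact: ltW.
move/(ae_eq_integral_abs mu measurableT mgp).
apply: (@filterS _ _ (ae_filter_ringOfSetsType mu)) => x /(_ I) /(poweR_eq0_eq0 (g0 x)) gx e e0.
have : (g x < e%:E)%E by rewrite gx lte_fin.
by move=> /ereal_inf_lt[_ [N _ <-]] /ltW; exists N.
Qed.

End AlmostEverywhere.

(** * Use of the hypothesis and conclusion *)

Section Assembly.
Context (R : realType) (m : nat -> nat) (hm2 : forall k, (2 <= m k)%N).
Context (p : R) (p0 : 0 < p) (p2 : p <= 2^-1).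

Let p1 : p < 1.
Proof. by apply: le_lt_trans p2 _; rewrite invf_lt1// ltr1n. Qed.

Definition logexp : R := 2 * (Num.floor (2^-1 + p))%:~R.

Lemma logexp_lt : p < 2^-1 -> logexp = 0.
Proof.
move=> h; rewrite /logexp (_ : Num.floor _ = 0) ?mulr0//.
by apply/eqP; rewrite floor_eq add0r mulr0z mulr1z; apply/andP; split; move: p0 h; lra.
Qed.

Lemma logexp_half : p = 2^-1 -> logexp = 2.
Proof.
move=> ph; rewrite /logexp ph (_ : Num.floor _ = 1) ?mulr1//.
by apply/eqP; rewrite floor_eq intrD mulr1z; apply/andP; split; lra.
Qed.

Lemma logexp_ge0 : 0 <= logexp.
Proof. by rewrite /logexp mulr_ge0// ler0z floor_ge0; move: p0; lra. Qed.

(** For [p < 1/2] the bound [M_j >= 2^j] leaves a convergent geometric series and [logexp] is 0. At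
    [p = 1/2] every summand is 1, so [Lam N = N+1 <= 2N], and [logexp * p = 1]. *)
Lemma Lam_bound : exists2 C : R, 0 < C &
  forall N, (0 < N)%N -> Lam m p N <= C * N%:R `^ (logexp * p).
Proof.
have [ph|ph] := ltP p 2^-1.
- rewrite logexp_lt//; set q : R := 2 `^ (2 * p - 1).
  have q0 : 0 < q by exact: powR_gt0.
  have q1 : q < 1.
    rewrite /q -[2 * p - 1]opprB powRN invf_lt1 ?powR_gt0//.
    have r0 : 0 < 1 - 2 * p by lra.
    by have := @gt0_ltr_powR R _ r0 1 2; rewrite powR1 !nnegrE; apply=> //; rewrite ltr1n.
  exists (1 - q)^-1; first by rewrite invr_gt0 subr_gt0.
  move=> N _; rewrite mul0r powRr0 mulr1.
  apply: (@le_trans _ _ (\sum_(j < N.+1) q ^+ j)).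
    apply: ler_sum => j _; rewrite /q -[2 * p - 1]opprB !powRN exprVn lef_pV2; first last.
    - by rewrite posrE ?exprn_gt0 ?powR_gt0 ?MseqR_gt0.
    - by rewrite posrE ?exprn_gt0 ?powR_gt0 ?MseqR_gt0.
    rewrite -powR_mulrn ?powR_ge0// powRAC powR_mulrn//.
    apply: ge0_ler_powR; rewrite ?nnegrE ?exprn_ge0 ?(ltW (MseqR_gt0 _ _ _))//; first lra.
    rewrite -natrX ler_nat; have := leq_pow2_Mseq hm2 0 j; by rewrite muln1.
  have := subrX1 q N.+1; set S := \sum_(_ < _) _ => h.
  have qN : 0 <= q ^+ N.+1 by rewrite exprn_ge0// ltW.
  by rewrite -[leRHS]mul1r ler_pdivlMr ?subr_gt0//; nra.
- have pE : p = 2^-1 by apply/eqP; rewrite eq_le p2.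
  exists 2 => // N N0; rewrite logexp_half// pE mulfV ?pnatr_eq0// powRr1//.
  rewrite /Lam (eq_bigr (fun=> 1)) => [|j _]; last by rewrite mulfV ?pnatr_eq0// subrr powRr0.
  by rewrite sumr_const card_ord -natrM ler_nat; lia.
Qed.

Context (mu : {measure set Gm -> \bar R}) (hmu : is_Haar m mu).
Context (f : nat -> Gm -> R[i]) (hf : is_martingale mu f).
Hypothesis homega : forall eps : R, 0 < eps ->
       \forall N \near \oo,
         (modcont m mu p f N <=
          (eps / ((Mseq m N)%:R `^ (p^-1 - 2) * N%:R `^ logexp))%:E)%E.

Lemma modcont_powR_le eps : 0 < eps -> exists J, forall N, (J <= N)%N -> (0 < N)%N /\
  (modcont m mu p f N `^ p <=
    (eps / ((Mseq m N)%:R `^ (1 - 2 * p) * N%:R `^ (logexp * p)))%:E)%E.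
Proof.
(* The hypothesis is used with [eps^(1/p)], since the modulus is raised to the power [p]; the
   exponents become [(1/p - 2) p = 1 - 2p] and [logexp * p]. Taking [N >= 1] keeps the power of [N]
   positive. *)
move=> e0; have [J _ hJ] := homega (powR_gt0 p^-1 e0).
exists (maxn J 1) => N; rewrite geq_max => /andP[JN N0]; split => //.
have M0 := @MseqR_gt0 R m hm2 N.
have N0' : 0 < N%:R :> R by rewrite ltr0n.
apply: le_trans (le_poweR (ltW p0) _ (hJ N JN)) _; first exact: Lnorm_ge0.
rewrite poweR_EFin lee_fin powRM ?invr_ge0 ?powR_ge0 ?mulr_ge0 ?powR_ge0//.
rewrite -powRrM mulVf ?(gt_eqF p0)// powRr1 ?(ltW e0)//.
rewrite -powR_inv1 ?mulr_ge0 ?powR_ge0// powRAC powR_inv1 ?powR_ge0//.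
rewrite powRM ?powR_ge0// -!powRrM mulrBl mulVf ?(gt_eqF p0)//.
Qed.

Lemma modcont_powR_small eps : 0 < eps -> exists J, forall N, (J <= N)%N ->
  (modcont m mu p f N `^ p <= eps%:E)%E.
Proof.
move=> e0; have [J hJ] := modcont_powR_le e0; exists J => N /hJ[N0 h].
apply: le_trans h _; rewrite lee_fin ler_pdivrMr; last first.
  by rewrite mulr_gt0 ?powR_gt0 ?MseqR_gt0 ?ltr0n.
rewrite ler_peMr ?(ltW e0)//.
have a1 : 1 <= (Mseq m N)%:R `^ (1 - 2 * p) :> R.
  have := @ler_powR R _ (@MseqR_ge1 R m hm2 N) 0 (1 - 2 * p); rewrite powRr0; apply.
  by move: p2; lra.
have b1 : 1 <= N%:R `^ (logexp * p) :> R.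
  have h1 : 1 <= N%:R :> R by rewrite ler1n.
  have := @ler_powR R _ h1 0 (logexp * p); rewrite powRr0; apply.
  by rewrite mulr_ge0 ?logexp_ge0 ?ltW.
nra.
Qed.

Lemma wmoment_small : eventually_small (wmoment m f p).
Proof.
move=> eps e0; have [C C0 hC] := Lam_bound.
have [J hJ] := modcont_powR_le (divr_gt0 e0 C0); exists J => N /hJ[N0 h].
have := le_trans (dmoment_le_modcont hm2 hmu hf p0 N) h; rewrite lee_fin => hd.
have M0 : 0 < (Mseq m N)%:R `^ (1 - 2 * p) :> R by rewrite powR_gt0 ?MseqR_gt0.
have L0 : 0 < N%:R `^ (logexp * p) :> R by rewrite powR_gt0 ?ltr0n.
rewrite /wmoment; set M := _ `^ _ in M0 hd *; set L := N%:R `^ _ in L0 hd hC.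
have hL : Lam m p N <= C * L by exact: hC.
have d0 := dmoment_ge0 m f p N.
apply: (@le_trans _ _ (C * L * M * (eps / C / (M * L)))).
  apply: ler_pM => //; last by apply: ler_wpM2r hL; exact: ltW.
  by apply: mulr_ge0 (ltW M0); exact: le_trans ler01 (Lam_ge1 _ _ _).
by rewrite le_eqVlt; apply/orP; left; apply/eqP; field; rewrite !gt_eqF.
Qed.

Context (B : nat) (hB : forall k, (m k <= B)%N).

Lemma fejer_error N n : (Mseq m N < n <= Mseq m N.+1)%N ->
  (\int[mu]_x (normc (fejer m mu f n x - mart_lim f x) `^ p)%:E <=
   (block_const B p * geom_conv (2^-1 `^ p) (wmoment m f p) N)%:E
   + modcont m mu p f N `^ p)%E.
Proof.
move=> hn; have /andP[_ nN] := hn.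
pose g x := normc (n%:R^-1 * fejer_sum m f n x - f N x) `^ p.
have gN : level N.+1 g.
  move=> x y xy; rewrite /g (level_le (leqnSn N) (martingale_level hf (k := N)) xy).
  suff -> : fejer_sum m f n x = fejer_sum m f n y by [].
  apply: eq_bigr => i _.
  by rewrite (psi_level R hm2 (leq_trans (ltn_ord i) nN) xy).
have mg := level_measurable_EFin gN.
have mh : measurable_fun [set: Gm] (fun x => tailmax f N x `^ p)%E.
  exact: measurableT_comp (measurable_poweR p) (tailmax_measurable hf N).
apply: (@le_trans _ _ (\int[mu]_x ((g x)%:E + tailmax f N x `^ p))%E); last first.
  rewrite ge0_integralD//; first last.
  - by move=> x _; exact: poweR_ge0.
  - by move=> x _; rewrite lee_fin powR_ge0.
  apply: leeD; last exact: (tailmax_moment hm2 hmu hf p0).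
  rewrite (integral_level hm2 hmu gN) lee_fin.
  exact: (fejer_moment hm2 (martingale_level hf) (martingale_children hm2 hmu hf) hB p0 p2).
have g0 x : (0 <= (g x)%:E)%E by rewrite lee_fin powR_ge0.
apply: ae_le_integral_nonmeas.
- by move=> x; rewrite lee_fin powR_ge0.
- by move=> x; rewrite adde_ge0 ?poweR_ge0.
- exact: emeasurable_funD.
have ae_conv : {ae mu, forall x, tail_vanishing f x}.
  apply: (ae_tail_vanishing hm2 hmu hf p0) => eps /modcont_powR_small[J hJ].
  by exists J; exact: hJ.
apply: (@filterS _ _ (ae_filter_ringOfSetsType mu) _ _ _ ae_conv) => x hx.
have := mart_lim_tailmax N hx; have := tailmax_ge0 f N x.
case: (tailmax f N x) => [c| |]//.
  rewrite lee_fin => c0; rewrite lee_fin => hc; rewrite ?poweR_EFin -?EFinD lee_fin.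
  rewrite (fejerE hm2 hmu hf).
  have -> : n%:R^-1 * fejer_sum m f n x - mart_lim f x =
     (n%:R^-1 * fejer_sum m f n x - f N x) + (f N x - mart_lim f x) by rewrite addrA subrK.
  apply: le_trans (powRD_le (ltW p1) (normc_ge0 _) c0).
  apply: (ler_powRp p0 (normc_ge0 _)); apply: le_trans (normcD_le _ _) _.
  by rewrite lerD2l.
(* Where the tail maximal function is infinite, so is the majorant. *)
by rewrite poweRyr ?gt_eqF// addey ?leey.
Qed.

(** [N] is the largest index with [M_N < n], which exists because [N < M_N]. *)
Lemma Mseq_bracket J n : (Mseq m J < n)%N ->
  exists2 N, (J <= N)%N & (Mseq m N < n <= Mseq m N.+1)%N.
Proof.
move=> hJ; have ex : exists N, (Mseq m N < n)%N by exists J.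
have bnd N : (Mseq m N < n)%N -> (N <= n)%N.
  by move=> h; apply: leq_trans (ltnW h); exact/ltnW/ltn_Mseq.
case: (ex_maxnP ex bnd) => N hN maxN; exists N; first exact: maxN.
by rewrite hN leqNgt; apply/negP => /maxN; rewrite ltnn.
Qed.

Lemma fejer_Lp_cvg :
  (fun n => Lp_norm mu p (fun x => fejer m mu f n x - mart_lim f x)) @ \oo --> 0%E.
Proof.
apply: nneg_cvge0 => [n|eps e0]; first exact: Lnorm_ge0.
have e2 : 0 < eps `^ p / 2 by rewrite divr_gt0 ?powR_gt0.
have q01 : 0 <= (2^-1 : R) `^ p < 1.
  rewrite powR_ge0 /=; have := @gt0_ltr_powR R _ p0 2^-1 1.
  by rewrite powR1 !nnegrE; apply=> //; rewrite invf_lt1// ltr1n.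
have C0 : 0 <= block_const B p.
  by rewrite addr_ge0 ?powR_ge0// mulr_ge0 ?powR_ge0// Psi_const_ge0.
have C1 : 0 < 1 + block_const B p by rewrite ltr_pwDl.
(* All estimates concern [p]-th powers, so the target [eps^p] is halved between the Fejer error and
   the modulus; adding 1 to [block_const] keeps the divisor positive. *)
have [J1 hJ1] := geom_conv_small q01 (wmoment_ge0 m f p) wmoment_small (divr_gt0 e2 C1).
have [J2 hJ2] := modcont_powR_small e2.
exists (Mseq m (maxn J1 J2)).+1 => // n /= /Mseq_bracket[N].
rewrite geq_max => /andP[JN1 JN2] hn.
rewrite -[eps%:E](@poweRe1 _ _) ?lee_fin ?(ltW e0)// -(mulfV (lt0r_neq0 p0)) poweRrM.
rewrite /Lp_norm unlock; apply: le_poweR; first by rewrite invr_ge0 ltW.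
  by apply: integral_ge0 => x _; exact: poweR_ge0.
rewrite (eq_integral (fun x => (normc (fejer m mu f n x - mart_lim f x) `^ p)%:E)); last first.
  by move=> x _; rewrite gee0_abs ?lee_fin ?normc_ge0// poweR_EFin.
apply: le_trans (fejer_error hn) _.
rewrite poweR_EFin [eps `^ p]splitr EFinD; apply: leeD; last exact: hJ2.
rewrite lee_fin; have := hJ1 N JN1; set G := geom_conv _ _ _ => hG.
have G0 : 0 <= G.
  apply: sumr_ge0 => j _; rewrite mulr_ge0 ?wmoment_ge0// exprn_ge0//.
apply: le_trans (_ : (1 + block_const B p) * G <= _).
  by apply: ler_wpM2r => //; rewrite lerDr.
by rewrite mulrC -ler_pdivlMr.
Qed.

End Assembly.

Theorem theorem1 (R : realType) (m : nat -> nat)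
    (hm2 : forall k, (2 <= m k)%N)
    (hmbd : exists B : nat, forall k, (m k <= B)%N)
    (mu : {measure set Gm -> \bar R}) (hmu : is_Haar m mu)
    (p : R) (hp0 : 0 < p) (hp : p <= 2^-1)
    (f : nat -> Gm -> R[i]) (hf : in_Hp mu p f)
    (homega : forall eps : R, 0 < eps ->
       \forall N \near \oo,
         (modcont m mu p f N <=
          (eps / ((Mseq m N)%:R `^ (p^-1 - 2)
                  * N%:R `^ (2 * (Num.floor (2^-1 + p))%:~R)))%:E)%E) :
  (fun n => Lp_norm mu p (fun x => fejer m mu f n x - mart_lim f x))
    @ \oo --> 0%E.
Proof.
have [B hB] := hmbd; case: hf => hmart _.
exact: (fejer_Lp_cvg hm2 hp0 hp hmu hmart homega hB).
Qed.
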